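(* Let $f:\mathbb{R}^d\to\mathbb{R}$ be continuous with $\lim_{\|x\|\to+\infty}f(x)=-\infty$, with a unique global maximum point $x^*=\arg\max_{x\in\mathbb{R}^d} f(x)$, and Lipschitz on $\mathbb{R}^d$ with constant $L_f$. Let $(\alpha_t)_{t\ge 0}$ satisfy $\alpha_t>0$, $\sum_{t=0}^\infty \alpha_t^2<\infty$ and $\sum_{t=0}^\infty\alpha_t=\infty$. Let $\mu_0\in\mathbb{R}^d$ be deterministic, let $N,b,\sigma_0>0$, let $\beta\in[0,1)$, let $K\geq 1$ be an integer, and let $(\mu_t,\sigma_t)_{t\ge 1}$ be generated by the GS-PowerHP iteration. For each positive integer $T$ define $$\nu_T:=\min_{\tau\in\{0,1,\dots,T\}}\mathbb{E}\big[\|\nabla F_{N,\sigma_{\tau+1}}(\mu_\tau)\|^2\big].$$ Then $$\nu_T=\mathcal{O}_N\Big((\sigma_0\beta^T+b)^{-2}\Big(\sum_{t=0}^{T-1}\alpha_t\Big)^{-1}\Big),$$ that is, there is a constant $C>0$, which may depend on $N$, $d$, $f$, $\mu_0$, $\sigma_0$ and $(\alpha_t)$ but not on $T$, $\beta$ or $b$, such that $\nu_T\le C(\sigma_0\beta^T+b)^{-2}\big(\sum_{t=0}^{T-1}\alpha_t\big)^{-1}$ for all positive integers $T$. Furthermore, if in addition $f(x)<0$ for all $x\in\mathbb{R}^d$, then $C$ can be chosen independent of $N$.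
   Context: For $N>0$, $\sigma>0$, write $f_N(x)=e^{Nf(x)}$ and $F_{N,\sigma}(\mu)=\mathbb{E}_{x\sim\mathcal{N}(\mu,\sigma^2 I_d)}[f_N(x)]$ for $\mu\in\mathbb{R}^d$; $\nabla F_{N,\sigma}$ is the gradient in $\mu$. $\|\cdot\|$ is the Euclidean norm. GS-PowerHP iteration: given an initial point $\mu_0\in\mathbb{R}^d$, step sizes $\alpha_t$, power $N>0$, parameters $\sigma_0>0$, $b>0$, $\beta$, and sample size $K\ge1$, for $t=0,1,2,\dots$ set $$\sigma_{t+1}=\sigma_0\beta^{t+1}+b,\qquad \mu_{t+1}=\mu_t+\alpha_t\,\hat\nabla F_{N,\sigma_{t+1}}(\mu_t),$$ where $\hat\nabla F_{N,\sigma_{t+1}}(\mu_t)=\frac1K\sum_{k=1}^K (w_k-\mu_t)f_N(w_k)$ and, conditionally on $\mu_t$ (and the past), $w_1,\dots,w_K$ are fresh independent samples from $\mathcal{N}(\mu_t,\sigma_{t+1}^2I_d)$. Expectations $\mathbb{E}$ are over all sampling randomness. *)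

(* Defs.v *)
From HB Require Import structures.
From mathcomp Require Export all_boot all_order all_algebra.
From mathcomp Require Export all_classical all_reals all_analysis.
Export Order.TTheory GRing.Theory Num.Theory.
Export numFieldNormedType.Exports.

Set Implicit Arguments.
Unset Strict Implicit.
Unset Printing Implicit Defensive.

Local Open Scope classical_set_scope.
Local Open Scope ring_scope.

(* R^d is 'rV[R]_d with the Borel sigma-algebra, presented as the
   sigma-algebra generated by the coordinates. The topology of 'rV[R]_d (that
   of the sup norm) is the Euclidean one, but the norm `|x| of 'rV[R]_d is the
   sup norm, hence the separate [enorm] below. *)

Definition measure_rV_display : measure_display.
Proof. exact: default_measure_display. Qed.

Section measurable_rV.
Variables (R : realType) (n : nat).

Definition rV_coord (i : 'I_n) (x : 'rV[R]_n) : R := x ord0 i.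

Let rV_set0 : g_sigma_preimage rV_coord set0.
Proof. exact: sigma_algebra0. Qed.

Let rV_setC A : g_sigma_preimage rV_coord A -> g_sigma_preimage rV_coord (~` A).
Proof. exact: sigma_algebraC. Qed.

Let rV_bigcup (F : (set 'rV[R]_n)^nat) :
  (forall i, g_sigma_preimage rV_coord (F i)) ->
  g_sigma_preimage rV_coord (\bigcup_i (F i)).
Proof. exact: sigma_algebra_bigcup. Qed.

HB.instance Definition _ := @isMeasurable.Build measure_rV_display
  'rV[R]_n (g_sigma_preimage rV_coord) rV_set0 rV_setC rV_bigcup.

End measurable_rV.

Section product_probability_rV.
Variable R : realType.

Lemma measurable_rV_coord n (i : 'I_n) :
  measurable_fun [set: 'rV[R]_n] (rV_coord i).
Proof.
move=> _ Y mY; rewrite setTI; apply: sub_sigma_algebra => /=.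
rewrite -bigcup_seq/=; exists i => /=; first by rewrite mem_index_enum.
by exists Y => //; rewrite setTI.
Qed.

Lemma measurable_fun_rVP d (T : measurableType d) n (f : T -> 'rV[R]_n) :
  measurable_fun [set: T] f <->
  forall i, measurable_fun [set: T] (fun t => f t ord0 i).
Proof.
split=> [mf i|mf].
  exact: (measurableT_comp (measurable_rV_coord i) mf).
have sub : measurable `<=` [set A | measurable (f @^-1` A)].
  apply: smallest_sub => /=.
    split=> /=; first by rewrite preimage_set0.
      by move=> A mA; rewrite setTD preimage_setC; exact: measurableC.
    by move=> F mF; rewrite preimage_bigcup; exact: bigcupT_measurable.
  rewrite -bigcup_seq; apply: bigcup_sub => i _ A [B mB <-] /=.
  by have := mf i measurableT B mB; rewrite !setTI.
by move=> _ A mA; rewrite setTI; exact: sub.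
Qed.

Definition rV_cons n (p : measurableTypeR R * 'rV[R]_n) : 'rV[R]_n.+1 :=
  \row_i (if unlift ord0 i is Some j then p.2 ord0 j else p.1).

Lemma measurable_rV_cons n :
  measurable_fun [set: measurableTypeR R * 'rV[R]_n] (@rV_cons n).
Proof.
apply/measurable_fun_rVP => i; under eq_fun do rewrite mxE.
case: (unlift ord0 i) => [j|]; last exact: measurable_fst.
exact: (measurableT_comp (measurable_rV_coord j) measurable_snd).
Qed.

HB.instance Definition _ n :=
  isMeasurableFun.Build _ _ _ _ (@rV_cons n) (@measurable_rV_cons n).

(* law of a row vector with independent coordinates, the i-th having law P i *)
Fixpoint rV_product_prob n : ('I_n -> probability (measurableTypeR R) R) ->
    probability 'rV[R]_n R :=
  match n with
  | 0 => fun=> \d_(0 : 'rV[R]_0)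
  | n'.+1 => fun P => distribution
      (P ord0 \x rV_product_prob (fun i => P (lift ord0 i)))%E
      (@rV_cons n' : {mfun (measurableTypeR R * 'rV[R]_n')%type >-> 'rV[R]_n'.+1})
  end.

End product_probability_rV.

Section gs_powerhp.
Variables (R : realType) (d : nat).
Implicit Types (f g : 'rV[R]_d -> R) (m mu x : 'rV[R]_d) (s N : R).

Definition enorm x : R := Num.sqrt (\sum_(i < d) x ord0 i ^+ 2).

(* N(m, s^2 I_d); as in [normal_prob], s is the standard deviation *)
Definition gaussian m s : probability 'rV[R]_d R :=
  rV_product_prob (fun i => normal_prob (m ord0 i) s).

Definition tends_to_ninfty f : Prop :=
  forall A : R, exists r : R, forall x, r < enorm x -> f x < A.

Definition unique_argmax f x : Prop :=
  (forall y, f y <= f x) /\ (forall y, (forall z, f z <= f y) -> y = x).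

Definition elipschitz f (L : R) : Prop :=
  forall x y, `|f x - f y| <= L * enorm (x - y).

Definition gradient g m : 'rV[R]_d := \row_(i < d) 'D_(delta_mx ord0 i) g m.

Definition fpow f N x : R := expR (N * f x).

Definition smoothed f N s mu : R := fine 'E_(gaussian mu s)[fpow f N].

(* sigma_t; only the values at t >= 1 are used *)
Definition sigma_sched (sigma0 beta b : R) (t : nat) : R :=
  sigma0 * beta ^+ t + b.

Definition grad_estimate f N (K : nat) (w : 'I_K -> 'rV[R]_d) mu : 'rV[R]_d :=
  K%:R^-1 *: \sum_(k < K) fpow f N (w k) *: (w k - mu).

Section process.
Context {dO : measure_display} {Omega : measurableType dO}.
Variables (P : probability Omega R) (K : nat).
Variables (w : nat -> 'I_K -> Omega -> 'rV[R]_d) (mu : nat -> Omega -> 'rV[R]_d).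

(* the sigma-algebra generated by the samples drawn before step t; when mu 0 is
   deterministic, mu 0, ..., mu t are functions of these samples *)
Definition past (t : nat) : set (set Omega) :=
  <<s [set A | exists (u : nat) (k : 'I_K) (B : set 'rV[R]_d),
        [/\ (u < t)%N, measurable B & A = w u k @^-1` B]] >>.

(* Conditionally on the past, w t 0, ..., w t (K - 1) are i.i.d. of law
   N(mu t, s^2 I_d): \prod_k gaussian (mu t) s (B k) is a version of the
   conditional probability of the event (w t k \in B k for all k). *)
Definition fresh_gaussian_samples (t : nat) (s : R) : Prop :=
  forall (A : set Omega) (B : 'I_K -> set 'rV[R]_d),
    past t A -> (forall k, measurable (B k)) ->
    P (A `&` [set o | forall k, B k (w t k o)]) =
    (\int[P]_(o in A) (\prod_(k < K) fine (gaussian (mu t o) s (B k)))%:E)%E.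

Definition gs_powerhp f N (sigma0 beta b : R) (alpha : nat -> R) (mu0 : 'rV[R]_d)
    : Prop :=
  [/\ forall t k, measurable_fun [set: Omega] (w t k),
      forall o, mu 0%N o = mu0,
      forall t o, mu t.+1 o =
        mu t o + alpha t *: grad_estimate f N (fun k => w t k o) (mu t o)
    & forall t, fresh_gaussian_samples t (sigma_sched sigma0 beta b t.+1)].

(* valued in \bar R, so that an upper bound on it includes finiteness *)
Definition nu f N (sigma0 beta b : R) (T : nat) : \bar R :=
  \big[mine/+oo%E]_(tau < T.+1)
    'E_P[(fun o => enorm (gradient
      (smoothed f N (sigma_sched sigma0 beta b tau.+1)) (mu tau o)) ^+ 2)%R]%E.

End process.

(* C is quantified before b, beta, K, T and before the probability space
   carrying the process, hence independent of all of them *)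
Definition nu_bound f N (sigma0 : R) (alpha : nat -> R) (mu0 : 'rV[R]_d) (C : R)
    : Prop :=
  forall (b beta : R) (K : nat), 0 < b -> 0 <= beta < 1 -> (0 < K)%N ->
  forall (dO : measure_display) (Omega : measurableType dO)
    (P : probability Omega R) (w : nat -> 'I_K -> Omega -> 'rV[R]_d)
    (mu : nat -> Omega -> 'rV[R]_d),
  gs_powerhp P w mu f N sigma0 beta b alpha mu0 ->
  forall T : nat, (0 < T)%N ->
  (nu P mu f N sigma0 beta b T <=
    (C * (sigma0 * beta ^+ T + b) ^- 2 * (\sum_(0 <= t < T) alpha t)^-1)%:E)%E.

End gs_powerhp.

(* Main.v *)
(* Write F_s(m) for the expectation of g = e^(N f), with 0 <= g <= M, under
   N(m, s^2 I), that is F_s(m) = E[g(m + s z)] for a standard Gaussian z, and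
   G_s(m) for its gradient s^-1 E[z g(m + s z)].

   Shifting the Gaussian by u = h / s multiplies its density by
   W = exp(z.u - |u|^2 / 2), so that
     F_s(m + h) - F_s(m) - G_s(m).h = E[g(m + s z) (W - 1 - z.u)],
   which is at most M |h|^2 / s^2 in absolute value: this bound gives both the
   differentiability of F_s and its smoothness, with a constant that does not
   involve N.  The estimator has conditional mean s^2 G_s and second moment at
   most M^2 s^2 E|z|^2, hence one step of the iteration increases E[F_s] by at
   least a s^2 E|G_s|^2 - M^3 E|z|^2 a^2.  Passing from s to the next standard
   deviation s' costs at most (s - s') D E[1 + |z|^2], where D is a Lipschitz
   constant of g.  Summing over the steps, all the losses are bounded
   independently of b and beta since the decreases of s add up to at most
   sigma0, and 0 <= E[F_s] <= M.  If f < 0 then M = 1 and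
   D = Lf N e^(N max f) <= Lf / (- max f) do not depend on N. *)
Require Import Defs.
From HB Require Import structures.
From mathcomp Require Import measurable_realfun ring lra.

Set Implicit Arguments.
Unset Strict Implicit.
Unset Printing Implicit Defensive.

Local Open Scope classical_set_scope.
Local Open Scope ring_scope.

(** * Densities and the normal law *)

Section density.
Context d (T : measurableType d) (R : realType).
Variables (mu nu : {measure set T -> \bar R}) (rho : T -> R).
Hypotheses (mrho : measurable_fun [set: T] rho) (rho0 : forall x, 0 <= rho x).
Hypothesis nuE : forall A, measurable A -> nu A = (\int[mu]_(x in A) (rho x)%:E)%E.
Import HBNNSimple.

Let indicE A : measurable A ->
  (\int[nu]_x (\1_A x)%:E = \int[mu]_x ((\1_A x)%:E * (rho x)%:E))%E.
Proof.
move=> mA; rewrite integral_indic// setIT nuE// integral_mkcond.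
apply: eq_integral => x _; rewrite patchE indicE.
by case: (x \in A); rewrite ?mul1e ?mul0e.
Qed.

Let nnsfunE (g : {nnsfun T >-> R}) :
  (\int[nu]_x (g x)%:E = \int[mu]_x ((g x)%:E * (rho x)%:E))%E.
Proof.
transitivity (\int[nu]_x (\sum_(y \in range g) (y * \1_(g @^-1` [set y]) x)%:E))%E.
  by apply: eq_integral => x _; rewrite fimfunE -fsumEFin.
rewrite ge0_integral_fsum//; last 2 first.
  by move=> y; exact/measurable_EFinP/measurableT_comp.
  by move=> y x _; rewrite EFinM nnfun_muleindic_ge0.
transitivity (\int[mu]_x (\sum_(y \in range g)
    (y * \1_(g @^-1` [set y]) x)%:E * (rho x)%:E))%E; last first.
  apply: eq_integral => x _; rewrite [in RHS]fimfunE -fsumEFin//.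
  rewrite ge0_mule_fsuml// => y.
  by rewrite EFinM nnfun_muleindic_ge0.
rewrite ge0_integral_fsum//; last 2 first.
  move=> y; apply: emeasurable_funM => //; last exact/measurable_EFinP.
  by apply/measurable_EFinP; exact: measurable_funM.
  by move=> y x _; rewrite mule_ge0 ?lee_fin// -lee_fin EFinM nnfun_muleindic_ge0.
apply: eq_fsbigr => y; rewrite inE => -[z _ <-{y}].
under eq_integral do rewrite EFinM.
rewrite ge0_integralZl//; last 2 first.
  by apply/measurable_EFinP.
  by rewrite lee_fin.
rewrite indicE//.
under [RHS]eq_integral do rewrite EFinM -muleA.
rewrite ge0_integralZl//.
- by apply: emeasurable_funM => //; exact/measurable_EFinP.
- by move=> x _; rewrite mule_ge0// lee_fin.
- by rewrite lee_fin.
Qed.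

(** The hypothesis [nuE] is the case of indicators; linearity gives simple functions, and monotone
    convergence along [nnsfun_approx] gives the rest. *)
Lemma ge0_integral_density (g : T -> \bar R) :
  measurable_fun [set: T] g -> (forall x, (0 <= g x)%E) ->
  (\int[nu]_x g x = \int[mu]_x (g x * (rho x)%:E))%E.
Proof.
move=> mg g0; pose h := nnsfun_approx measurableT mg.
transitivity (limn (fun n => \int[nu]_x (h n x)%:E))%E.
  rewrite -monotone_convergence//=.
  - apply: eq_integral => x _; apply/esym/cvg_lim => //.
    exact: cvg_nnsfun_approx.
  - by move=> n; exact/measurable_EFinP/measurable_funTS.
  - by move=> n x _; rewrite lee_fin.
  - by move=> x _ m n mn; rewrite lee_fin; exact/lefP/nd_nnsfun_approx.
transitivity (limn (fun n => \int[mu]_x ((h n x)%:E * (rho x)%:E)))%E.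
  by apply: congr_lim; apply/funext => n; exact: nnsfunE.
rewrite -monotone_convergence//=.
- apply: eq_integral => x _; apply/cvg_lim => //.
  by apply: cvgeZr => //; exact: cvg_nnsfun_approx.
- move=> n; apply: emeasurable_funM; last exact/measurable_EFinP.
  exact/measurable_EFinP/measurable_funTS.
- by move=> n x _; rewrite mule_ge0// lee_fin.
- move=> x _ m n mn; rewrite lee_wpmul2r ?lee_fin//.
  exact/lefP/nd_nnsfun_approx.
Qed.
End density.

Section normal_integral.
Variable R : realType.
Implicit Types (m s u : R) (g : measurableTypeR R -> \bar R).
Local Notation leb := (@lebesgue_measure R).

Lemma ge0_integral_normal_prob m s g :
  measurable_fun [set: measurableTypeR R] g -> (forall x, (0 <= g x)%E) ->
  (\int[normal_prob m s]_x g x = \int[leb]_x (g x * (normal_pdf m s x)%:E))%E.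
Proof.
move=> mg g0; apply: ge0_integral_density => //.
- exact: measurable_normal_pdf.
- by move=> x; exact: normal_pdf_ge0.
Qed.

(** The pushforward of Lebesgue measure by [x |-> m + s * x], multiplied by [s], has the right value
    on half-open intervals, so it is Lebesgue measure by uniqueness. *)
Lemma ge0_integral_lebesgue_affine m s g : 0 < s ->
  measurable_fun [set: measurableTypeR R] g -> (forall x, (0 <= g x)%E) ->
  (\int[leb]_x g x = s%:E * \int[leb]_x g (m + s * x)%R)%E.
Proof.
move=> s0 mg g0.
pose phi (x : measurableTypeR R) : measurableTypeR R := m + s * x.
have mphi : measurable_fun [set: measurableTypeR R] phi.
  by apply: measurable_funD => //; exact: measurable_funM.
pose nu0 : {measure set (measurableTypeR R) -> \bar R} :=
  measure_function_pushforward__canonical__measure_function_Measure leb mphi.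
pose nu := [the measure _ _ of mscale (NngNum (ltW s0)) nu0].
have nuE A : measurable A -> leb A = nu A.
  apply: lebesgue_measure_unique => X -[[a b] /= _ <-].
  rewrite /nu /= /mscale /= /pushforward.
  have -> : phi @^-1` `]a, b] = `](a - m) / s, (b - m) / s]%classic.
    apply/seteqP; split=> x /=; rewrite !in_itv/= ltr_pdivrMr// ler_pdivlMr// /phi mulrC; lra.
  rewrite !lebesgue_measure_itv/= !lte_fin ltr_pM2r ?invr_gt0// ltrBlDr subrK.
  case: ifP => _; last by rewrite mule0.
  rewrite -!EFinD -EFinM; congr EFin.
  field. by rewrite gt_eqF.
rewrite (eq_measure_integral nu); last by move=> A mA _; exact: nuE.
rewrite ge0_integral_mscale//= ge0_integral_pushforward//.
Qed.

Lemma ge0_integral_normal_affine m s g : 0 < s ->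
  measurable_fun [set: measurableTypeR R] g -> (forall x, (0 <= g x)%E) ->
  (\int[normal_prob m s]_x g x = \int[normal_prob 0 1]_x g (m + s * x)%R)%E.
Proof.
move=> s0 mg g0.
have mphi : measurable_fun [set: measurableTypeR R]
    (fun x : measurableTypeR R => (m + s * x : measurableTypeR R)).
  by apply: measurable_funD => //; exact: measurable_funM.
rewrite (ge0_integral_normal_prob m s mg g0).
rewrite (ge0_integral_normal_prob 0 1 (measurableT_comp mg mphi) (fun=> g0 _)).
rewrite (ge0_integral_lebesgue_affine m s0); last 2 first.
  apply: emeasurable_funM => //; apply/measurable_EFinP.
  exact: measurable_normal_pdf.
  by move=> x; rewrite mule_ge0// lee_fin normal_pdf_ge0.
rewrite -ge0_integralZl//; last 3 first.
- apply: emeasurable_funM; first exact: (measurableT_comp mg).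
  apply/measurable_EFinP; apply: (measurableT_comp _ mphi).
  exact: measurable_normal_pdf.
- by move=> x _; rewrite mule_ge0// lee_fin normal_pdf_ge0.
- by rewrite lee_fin ltW.
apply: eq_integral => x _; rewrite muleCA -EFinM; congr (_ * _%:E)%E.
rewrite !normal_pdfE ?oner_eq0 ?gt_eqF// mulrA; congr (_ * expR _).
  rewrite /normal_peak expr1n mul1r -mulrnAr sqrtrM ?sqr_ge0//.
  by rewrite sqrtr_sqr gtr0_norm// invfM mulrA divff ?mul1r// gt_eqF.
rewrite subr0 addrC addKr exprMn expr1n.
by field; rewrite gt_eqF.
Qed.

(** One-dimensional Cameron-Martin formula: the exponential is the ratio of the densities of N(u, 1)
    and N(0, 1). *)
Lemma ge0_integral_normal_shift u g :
  measurable_fun [set: measurableTypeR R] g -> (forall x, (0 <= g x)%E) ->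
  (\int[normal_prob 0 1]_x g (x + u)%R =
   \int[normal_prob 0 1]_x (g x * (expR (x * u - u ^+ 2 / 2))%:E))%E.
Proof.
move=> mg g0.
transitivity (\int[normal_prob u 1]_x g x)%E.
  rewrite (ge0_integral_normal_affine u (@ltr01 R) mg g0).
  by apply: eq_integral => x _; rewrite mul1r addrC.
have mh : measurable_fun [set: measurableTypeR R]
    (fun x => g x * (expR (x * u - u ^+ 2 / 2))%:E)%E.
  apply: emeasurable_funM => //; apply/measurable_EFinP.
  apply: measurableT_comp => //; apply: measurable_funB => //.
  exact: measurable_funM.
have h0 x : (0 <= g x * (expR (x * u - u ^+ 2 / 2))%:E)%E.
  by rewrite mule_ge0// lee_fin expR_ge0.
rewrite (ge0_integral_normal_prob u 1 mg g0) (ge0_integral_normal_prob 0 1 mh h0).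
apply: eq_integral => x _; rewrite -muleA -EFinM; congr (_ * _%:E)%E.
rewrite !normal_pdfE ?oner_eq0// mulrCA; congr (_ * _).
rewrite /normal_fun -expRD; congr expR.
by rewrite expr1n; field.
Qed.

End normal_integral.

(** * Products of normal laws *)

Section rV_product_integral.
Variable R : realType.

Lemma ge0_integral_rV_product_probS n (P : 'I_n.+1 -> probability (measurableTypeR R) R)
    (g : 'rV[R]_n.+1 -> \bar R) :
  measurable_fun [set: 'rV[R]_n.+1] g -> (forall x, (0 <= g x)%E) ->
  (\int[rV_product_prob P]_x g x =
   \int[P ord0]_x \int[rV_product_prob (fun i => P (lift ord0 i))]_y
     g (rV_cons (x, y)))%E.
Proof.
move=> mg g0; rewrite ge0_integral_distribution// fubini_tonelli1//.
- exact: (measurableT_comp mg (@measurable_rV_cons R n)).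
- by move=> x; exact: g0.
Qed.

Lemma measurable_rV_map n (phi : 'I_n -> R -> R) :
  (forall i, measurable_fun [set: R] (phi i)) ->
  measurable_fun [set: 'rV[R]_n] (fun x : 'rV[R]_n => \row_i phi i (x ord0 i)).
Proof.
move=> mphi; apply/measurable_fun_rVP => i; under eq_fun do rewrite mxE.
exact: (measurableT_comp (mphi i) (measurable_rV_coord i)).
Qed.

Lemma measurable_rV_prod n (rho : 'I_n -> R -> R) :
  (forall i, measurable_fun [set: R] (rho i)) ->
  measurable_fun [set: 'rV[R]_n] (fun x : 'rV[R]_n => \prod_i rho i (x ord0 i)).
Proof.
move=> mrho; apply: measurable_prod => i _.
exact: (measurableT_comp (mrho i) (measurable_rV_coord i)).
Qed.

(** Common source of two changes of variables: the affine one ([phi] affine, [rho] = 1) and the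
    Cameron-Martin one ([phi] the identity, [rho] the density ratio). The induction peels off one
    coordinate at a time by Tonelli. *)
Lemma ge0_integral_rV_product_change n
    (P Q : 'I_n -> probability (measurableTypeR R) R) (phi rho : 'I_n -> R -> R) :
  (forall i, measurable_fun [set: R] (phi i)) ->
  (forall i, measurable_fun [set: R] (rho i)) ->
  (forall i x, 0 <= rho i x) ->
  (forall i (g : measurableTypeR R -> \bar R),
    measurable_fun [set: measurableTypeR R] g -> (forall x, (0 <= g x)%E) ->
    (\int[P i]_x g x = \int[Q i]_x (g (phi i x) * (rho i x)%:E))%E) ->
  forall g : 'rV[R]_n -> \bar R,
  measurable_fun [set: 'rV[R]_n] g -> (forall x, (0 <= g x)%E) ->
  (\int[rV_product_prob P]_x g x =
   \int[rV_product_prob Q]_x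
     (g (\row_i phi i (x ord0 i)) * (\prod_i rho i (x ord0 i))%:E))%E.
Proof.
elim: n P Q phi rho => [|n IH] P Q phi rho mphi mrho rho0 PQ g mg g0.
  have -> : rV_product_prob P = rV_product_prob Q by [].
  apply: eq_integral => x _; rewrite big_ord0 mule1; congr g.
  by apply/rowP => -[].
have mh : measurable_fun [set: 'rV[R]_n.+1]
  (fun x => g (\row_i phi i (x ord0 i)) * (\prod_i rho i (x ord0 i))%:E)%E.
  apply: emeasurable_funM; first exact: (measurableT_comp mg (measurable_rV_map mphi)).
  by have /measurable_EFinP := measurable_rV_prod mrho.
rewrite !ge0_integral_rV_product_probS//; last first.
  by move=> x; rewrite mule_ge0// lee_fin prodr_ge0.
have mgc : measurable_fun [set: measurableTypeR R * 'rV[R]_n] (g \o @rV_cons R n).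
  exact: (measurableT_comp mg (@measurable_rV_cons R n)).
rewrite PQ; last 2 first.
- exact: (@measurable_fun_fubini_tonelli_F _ _ _ _ _
    (rV_product_prob (fun i => P (lift ord0 i))) _ mgc (fun=> g0 _)).
- by move=> x; exact: integral_ge0.
apply: eq_integral => x _.
have mgx : measurable_fun [set: 'rV[R]_n] (fun y => g (rV_cons (phi ord0 x, y))).
  exact: (measurableT_comp mgc (pair1_measurable _)).
rewrite (IH _ (fun i => Q (lift ord0 i)) (fun i => phi (lift ord0 i))
  (fun i => rho (lift ord0 i)))//; last by move=> i; exact: PQ.
have mphi' := @measurable_rV_map _ _ (fun i => mphi (lift ord0 i)).
have mrho' := @measurable_rV_prod _ _ (fun i => mrho (lift ord0 i)).
rewrite -ge0_integralZr//; last 3 first.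
- apply: emeasurable_funM; last exact/measurable_EFinP.
  exact: (measurableT_comp mgx mphi').
- by move=> y _; rewrite mule_ge0// lee_fin prodr_ge0.
- by rewrite lee_fin.
apply: eq_integral => y _; rewrite -muleA -EFinM big_ord_recl [in RHS]mulrC.
congr (g _ * (_ * _)%:E)%E.
- apply/rowP => i; rewrite !mxE; case: unliftP => [j ->|->] //=.
  by rewrite !mxE.
- by apply: eq_bigr => i _; rewrite !mxE liftK.
- by rewrite !mxE unlift_none.
Qed.

Variable d : nat.
Implicit Types (m u x y : 'rV[R]_d) (g : 'rV[R]_d -> \bar R).

Definition dotp x y : R := \sum_(i < d) x ord0 i * y ord0 i.

Lemma ge0_integral_gaussian_affine m (s : R) g : 0 < s ->
  measurable_fun [set: 'rV[R]_d] g -> (forall x, (0 <= g x)%E) ->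
  (\int[gaussian m s]_x g x = \int[gaussian 0 1]_x g (m + s *: x)%R)%E.
Proof.
move=> s0 mg g0.
have mphi (i : 'I_d) : measurable_fun [set: R] (fun r => m ord0 i + s * r).
  by apply: measurable_funD => //; exact: measurable_funM.
have mrho (i : 'I_d) : measurable_fun [set: R] (fun=> 1 : R) by [].
pose P i : probability (measurableTypeR R) R := normal_prob (m ord0 i) s.
pose Q (i : 'I_d) : probability (measurableTypeR R) R :=
  normal_prob ((0 : 'rV[R]_d) ord0 i) 1.
have PQ i (h : measurableTypeR R -> \bar R) :
    measurable_fun [set: measurableTypeR R] h -> (forall r, (0 <= h r)%E) ->
    (\int[P i]_r h r = \int[Q i]_r (h (m ord0 i + s * r)%R * 1%:E))%E.
  move=> mh h0; rewrite (ge0_integral_normal_affine _ s0 mh h0) /Q mxE.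
  by apply: eq_integral => r _; rewrite mule1.
transitivity (\int[gaussian 0 1]_x
    (g (\row_i (m ord0 i + s * x ord0 i))%R * (\prod_(i < d) 1)%:E))%E.
  exact: (ge0_integral_rV_product_change mphi mrho (fun _ _ => ler01) PQ mg g0).
apply: eq_integral => x _; rewrite big1// mule1; congr g.
by apply/rowP => i; rewrite !mxE.
Qed.

(** The coordinatewise Cameron-Martin factors multiply to a single exponential. *)
Lemma ge0_integral_gaussian_shift u g :
  measurable_fun [set: 'rV[R]_d] g -> (forall x, (0 <= g x)%E) ->
  (\int[gaussian 0 1]_x g (x + u)%R =
   \int[gaussian 0 1]_x (g x * (expR (dotp x u - dotp u u / 2))%:E))%E.
Proof.
move=> mg g0.
transitivity (\int[gaussian u 1]_x g x)%E.
  rewrite (@ge0_integral_gaussian_affine u 1 g ltr01 mg g0).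
  by apply: eq_integral => x _; rewrite scale1r addrC.
have mphi (i : 'I_d) : measurable_fun [set: R] (@id R) by [].
have mrho (i : 'I_d) : measurable_fun [set: R]
    (fun r => expR (r * u ord0 i - u ord0 i ^+ 2 / 2)).
  apply: measurableT_comp => //; apply: measurable_funB => //.
  exact: measurable_funM.
pose P i : probability (measurableTypeR R) R := normal_prob (u ord0 i) 1.
pose Q (i : 'I_d) : probability (measurableTypeR R) R :=
  normal_prob ((0 : 'rV[R]_d) ord0 i) 1.
have PQ i (h : measurableTypeR R -> \bar R) :
    measurable_fun [set: measurableTypeR R] h -> (forall r, (0 <= h r)%E) ->
    (\int[P i]_r h r = \int[Q i]_r
      (h r * (expR (r * u ord0 i - u ord0 i ^+ 2 / 2))%:E))%E.
  move=> mh h0; rewrite /Q mxE -(ge0_integral_normal_shift _ mh h0).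
  rewrite (ge0_integral_normal_affine _ ltr01 mh h0).
  by apply: eq_integral => r _; rewrite mul1r addrC.
transitivity (\int[gaussian 0 1]_x (g (\row_i x ord0 i)%R *
    (\prod_(i < d) expR (x ord0 i * u ord0 i - u ord0 i ^+ 2 / 2))%:E))%E.
  exact: (ge0_integral_rV_product_change mphi mrho (fun _ _ => expR_ge0 _) PQ mg g0).
apply: eq_integral => x _; congr (g _ * _%:E)%E.
  by apply/rowP => i; rewrite !mxE.
rewrite -expR_sum; congr expR.
by rewrite sumrB -mulr_suml.
Qed.

End rV_product_integral.

(** * Integrability of real-valued functions *)

Section real_integrable.
Context dT (T : measurableType dT) (R : realType) (P : {measure set T -> \bar R}).
Implicit Types h k : T -> R.

Lemma le_integrableR h k : measurable_fun [set: T] h ->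
  (forall x, `|h x| <= k x) -> P.-integrable [set: T] (EFin \o k) ->
  P.-integrable [set: T] (EFin \o h).
Proof.
move=> mh hk ik; apply: le_integrable ik => //; first exact/measurable_EFinP.
by move=> x _; rewrite lee_fin (le_trans (hk x))// ler_norm.
Qed.

Lemma integrableDR h k : P.-integrable [set: T] (EFin \o h) ->
  P.-integrable [set: T] (EFin \o k) ->
  P.-integrable [set: T] (EFin \o (fun x => h x + k x)).
Proof. by move=> ih ik; exact: (integrableD measurableT ih ik). Qed.

Lemma integrableBR h k : P.-integrable [set: T] (EFin \o h) ->
  P.-integrable [set: T] (EFin \o k) ->
  P.-integrable [set: T] (EFin \o (fun x => h x - k x)).
Proof. by move=> ih ik; exact: (integrableB measurableT ih ik). Qed.

Lemma integrableZlR (c : R) h : P.-integrable [set: T] (EFin \o h) ->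
  P.-integrable [set: T] (EFin \o (fun x => c * h x)).
Proof. by move=> ih; exact: (integrableZl measurableT c ih). Qed.

Lemma integrable_sumR (I : Type) (s : seq I) (h : I -> T -> R) :
  (forall i, P.-integrable [set: T] (EFin \o h i)) ->
  P.-integrable [set: T] (EFin \o (fun x => \sum_(i <- s) h i x)).
Proof.
move=> ih; have := integrable_sum measurableT s (fun i (_ : true) => ih i).
by apply: eq_integrable => // x _ /=; rewrite sumEFin.
Qed.

Lemma Rintegral_sum (I : Type) (s : seq I) (h : I -> T -> R) :
  (forall i, P.-integrable [set: T] (EFin \o h i)) ->
  \int[P]_x (\sum_(i <- s) h i x) = \sum_(i <- s) \int[P]_x h i x.
Proof.
move=> ih; elim: s => [|i s IH].
  rewrite big_nil; under eq_Rintegral do rewrite big_nil.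
  by rewrite Rintegral_cst// mul0r.
rewrite big_cons -IH -RintegralD//; last exact: integrable_sumR.
by apply: eq_Rintegral => x _; rewrite big_cons.
Qed.

Lemma ge0_integrableR h (r : R) : measurable_fun [set: T] h ->
  (forall x, 0 <= h x) -> (\int[P]_x (h x)%:E <= r%:E)%E ->
  P.-integrable [set: T] (EFin \o h).
Proof.
move=> mh h0 hr; apply/integrableP; split; first exact/measurable_EFinP.
under eq_integral do rewrite /= ger0_norm//.
exact: le_lt_trans hr (ltry _).
Qed.

Lemma Rintegral_le_norm h k : P.-integrable [set: T] (EFin \o h) ->
  P.-integrable [set: T] (EFin \o k) -> (forall x, `|h x| <= k x) ->
  `|\int[P]_x h x| <= \int[P]_x k x.
Proof.
move=> ih ik hk; apply: (le_trans (le_normr_Rintegral _ ih)) => //.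
by apply: le_Rintegral => //; exact: integrable_norm.
Qed.

Lemma Rintegral_prob_cst (Q : probability T R) (c : R) : \int[Q]_x c = c.
Proof. by rewrite /Rintegral integral_cst//= probability_setT mule1. Qed.

Lemma integrable_cstR (Q : probability T R) (c : R) :
  Q.-integrable [set: T] (EFin \o cst c).
Proof. exact: finite_measure_integrable_cst. Qed.

End real_integrable.

(** * Exponential and polynomial moments of the standard Gaussian *)

Section gaussian_moments.
Variables (R : realType) (d : nat).
Implicit Types (m u z : 'rV[R]_d).
Local Notation gamma := (gaussian (0 : 'rV[R]_d) 1).

Lemma sqr_enormE z : enorm z ^+ 2 = dotp z z.
Proof.
rewrite sqr_sqrtr; first by apply: eq_bigr => i _; rewrite expr2.
by apply: sumr_ge0 => i _; rewrite sqr_ge0.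
Qed.

Lemma dotpZr (t : R) z u : dotp z (t *: u) = t * dotp z u.
Proof. by rewrite /dotp mulr_sumr; apply: eq_bigr => i _; rewrite mxE mulrCA. Qed.

Lemma dotpZl (t : R) z u : dotp (t *: z) u = t * dotp z u.
Proof. by rewrite /dotp mulr_sumr; apply: eq_bigr => i _; rewrite mxE mulrA. Qed.

Lemma dotp_ge0 z : 0 <= dotp z z.
Proof. by rewrite -sqr_enormE sqr_ge0. Qed.

Lemma measurable_dotp u : measurable_fun [set: 'rV[R]_d] (fun z => dotp z u).
Proof.
apply: measurable_sum => i; apply: measurable_funM => //.
exact: measurable_rV_coord.
Qed.

(** Density of N(u, I) with respect to N(0, I). *)
Definition tilt u z : R := expR (dotp z u - dotp u u / 2).

Lemma measurable_tilt u : measurable_fun [set: 'rV[R]_d] (tilt u).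
Proof.
by apply: measurableT_comp => //; apply: measurable_funB => //; exact: measurable_dotp.
Qed.

Lemma integral_tilt u : (\int[gamma]_z (tilt u z)%:E = 1)%E.
Proof.
have := @ge0_integral_gaussian_shift R d u (cst 1%E) (measurable_cst _) (fun=> lee01).
rewrite integral_cst//= probability_setT mule1 => /esym.
by under eq_integral do rewrite mul1e.
Qed.

Lemma integrable_tilt u : gamma.-integrable [set: 'rV[R]_d] (EFin \o tilt u).
Proof.
apply: (ge0_integrableR (measurable_tilt u) (r := 1)).
  by move=> z; exact: expR_ge0.
by rewrite integral_tilt.
Qed.

Lemma Rintegral_tilt u : \int[gamma]_z tilt u z = 1.
Proof. by rewrite /Rintegral integral_tilt. Qed.

Lemma tiltE u z : expR (dotp z u) = expR (dotp u u / 2) * tilt u z.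
Proof. by rewrite -expRD addrC subrK. Qed.

Lemma integrable_expR_dotp u :
  gamma.-integrable [set: 'rV[R]_d] (EFin \o (fun z => expR (dotp z u))).
Proof.
by under eq_fun do rewrite tiltE; exact: integrableZlR (integrable_tilt u).
Qed.

Lemma dotpN z u : dotp z (- u) = - dotp z u.
Proof. by rewrite -scaleN1r dotpZr mulN1r. Qed.

(** Since e^|y| <= e^y + e^-y, this follows from the exponential moments; it then dominates the
    first and second moments. *)
Lemma integrable_expR_norm_dotp u :
  gamma.-integrable [set: 'rV[R]_d] (EFin \o (fun z => expR `|dotp z u|)).
Proof.
apply: (le_integrableR (k := fun z => expR (dotp z u) + expR (dotp z (- u)))).
- apply: measurableT_comp => //; apply: measurableT_comp => //.
  exact: measurable_dotp.
- move=> z; rewrite ger0_norm ?expR_ge0//= dotpN.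
  by case: ger0P => _; [rewrite lerDl|rewrite lerDr]; exact: expR_ge0.
- exact: (integrableDR (integrable_expR_dotp u) (integrable_expR_dotp (- u))).
Qed.

Lemma integrable_dotp u : gamma.-integrable [set: 'rV[R]_d] (EFin \o (fun z => dotp z u)).
Proof.
apply: (le_integrableR _ _ (integrable_expR_norm_dotp u)).
  exact: measurable_dotp.
by move=> z; rewrite (le_trans _ (expR_ge1Dx _))// lerDr.
Qed.

Lemma integrable_sqr_dotp u :
  gamma.-integrable [set: 'rV[R]_d] (EFin \o (fun z => dotp z u ^+ 2)).
Proof.
apply: (le_integrableR _ _ (integrableZlR 2 (integrable_expR_norm_dotp u))).
  by apply: measurable_funX; exact: measurable_dotp.
move=> z; rewrite ger0_norm ?sqr_ge0// -[in leLHS]real_normK ?num_real//.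
have := expR_ge1Dxn 1 (normr_ge0 (dotp z u)).
rewrite (_ : 2`!%:R = 2 :> R)//; lra.
Qed.

(** Integrating 1 + t y <= e^(t y) with y = z.u gives 1 + t a <= e^(t^2 |u|^2 / 2), where [a] is the
    mean. Dividing by a small t > 0 leaves a <= e for every e > 0. *)
Let Rintegral_dotp_le0 u : \int[gamma]_z dotp z u <= 0.
Proof.
set a := Rintegral _ _ _; apply/ler_addgt0Pr => e e0; rewrite add0r.
set v := dotp u u; have v0 : 0 <= v by exact: dotp_ge0.
(* This choice gives t <= 1 and makes t v at most both 1 and e, hence the exponent [y] below at most
   1/2. *)
pose t := Num.min 1 e / (v + 1).
have t0 : 0 < t by rewrite divr_gt0 ?lt_min ?ltr01//; lra.
have le1 : 1 + t * a <= expR (t ^+ 2 * v / 2).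
  have -> : expR (t ^+ 2 * v / 2) =
      \int[gamma]_z (expR (t ^+ 2 * v / 2) * tilt (t *: u) z).
    by rewrite RintegralZl// ?Rintegral_tilt ?mulr1//; exact: integrable_tilt.
  have -> : 1 + t * a = \int[gamma]_z (1 + t * dotp z u).
    rewrite RintegralD//; first last.
    - exact: integrableZlR (integrable_dotp u).
    - exact: integrable_cstR.
    rewrite Rintegral_prob_cst RintegralZl//.
    exact: integrable_dotp.
  apply: le_Rintegral => //.
  - apply: integrableDR; first exact: integrable_cstR.
    exact: integrableZlR (integrable_dotp u).
  - exact: integrableZlR (integrable_tilt _).
  - move=> z _; have := tiltE (t *: u) z; rewrite !dotpZr dotpZl -/v.
    by rewrite mulrA -expr2 => <-; exact: expR_ge1Dx.
have tv : t * (v + 1) = Num.min 1 e by rewrite /t divfK//; lra.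
have tv1 : t * v <= Num.min 1 e by rewrite -tv ler_wpM2l ?(ltW t0)//; lra.
have t1 : t <= 1.
  by rewrite ler_pdivrMr ?mul1r; [rewrite ge_min; apply/orP; left; lra|lra].
set y := t ^+ 2 * v / 2 in le1.
have yE : y = t * (t * v) / 2 by rewrite /y; ring.
have m1 : Num.min 1 e <= 1 by rewrite ge_min lexx.
have me : Num.min 1 e <= e by rewrite ge_min lexx orbT.
have tv0 : 0 <= t * v by rewrite mulr_ge0// ltW.
have y2 : y <= 1 / 2 by rewrite yE; nra.
have y0 : 0 <= y by rewrite yE; nra.
(* From 1 - y <= e^-y; together with 0 <= y <= 1/2 it yields e^y <= 1 + 2 y. *)
have ey : expR y * (1 - y) <= 1.
  rewrite -[leRHS](expRxMexpNx_1 y) ler_wpM2l ?expR_ge0//.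
  exact: expR_ge1Dx.
have ey2 : expR y <= 1 + 2 * y by nra.
have tae : t * a <= t * (t * v).
  by apply: (le_trans (_ : _ <= 2 * y)); [lra|rewrite yE; lra].
by move: tae; rewrite ler_pM2l// => av; lra.
Qed.

(** The one-sided bound is applied to both [u] and [- u]. *)
Lemma Rintegral_dotp u : \int[gamma]_z dotp z u = 0.
Proof.
apply/eqP; rewrite eq_le Rintegral_dotp_le0/=.
have := Rintegral_dotp_le0 (- u).
under eq_Rintegral do rewrite dotpN -mulN1r.
rewrite RintegralZl//; last exact: integrable_dotp.
by rewrite mulN1r oppr_le0.
Qed.

Lemma coordE z (i : 'I_d) : z ord0 i = dotp z (delta_mx ord0 i).
Proof.
rewrite /dotp (bigD1 i)//= mxE !eqxx mulr1 big1 ?addr0// => j ji.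
by rewrite mxE eqxx (negbTE ji) mulr0.
Qed.

Lemma integrable_coord (i : 'I_d) :
  gamma.-integrable [set: 'rV[R]_d] (EFin \o (fun z => z ord0 i)).
Proof. by under eq_fun do rewrite coordE; exact: integrable_dotp. Qed.

Lemma integrable_sqr_enorm :
  gamma.-integrable [set: 'rV[R]_d] (EFin \o (fun z => enorm z ^+ 2)).
Proof.
under eq_fun do rewrite sqr_enormE.
apply: integrable_sumR => i; under eq_fun do rewrite -expr2 coordE.
exact: integrable_sqr_dotp.
Qed.

(** This number is d; it is carried as a symbolic constant. *)
Definition gauss_sqnorm : R := \int[gamma]_z enorm z ^+ 2.

Lemma gauss_sqnorm_ge0 : 0 <= gauss_sqnorm.
Proof. by apply: Rintegral_ge0 => z _; exact: sqr_ge0. Qed.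

End gaussian_moments.

(** * Gaussian smoothing of a bounded function *)

Section gaussian_smoothing.
Variables (R : realType) (d : nat) (g : 'rV[R]_d -> R) (M : R).
Hypothesis mg : measurable_fun [set: 'rV[R]_d] g.
Hypothesis g0 : forall x, 0 <= g x.
Hypothesis gM : forall x, g x <= M.
Implicit Types (m u z h : 'rV[R]_d) (s : R).
Local Notation gamma := (gaussian (0 : 'rV[R]_d) 1).

(** The parameters sit in the integrand and the measure is fixed, so that different centres and
    scales are compared under the same [z]. *)
Definition gsmooth s m : R := \int[gamma]_z g (m + s *: z).

(** Score-function form of the gradient, which involves no derivative of [g]. *)
Definition gsmooth_grad s m : 'rV[R]_d :=
  \row_i (s^-1 * \int[gamma]_z (z ord0 i * g (m + s *: z))).

Lemma measurable_affine_rV m s :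
  measurable_fun [set: 'rV[R]_d] (fun z : 'rV[R]_d => m + s *: z).
Proof.
apply/measurable_fun_rVP => i; under eq_fun do rewrite !mxE.
by apply: measurable_funD => //; apply: measurable_funM => //; exact: measurable_rV_coord.
Qed.

Lemma measurable_gsmooth_integrand s m :
  measurable_fun [set: 'rV[R]_d] (fun z => g (m + s *: z)).
Proof. exact: (measurableT_comp mg (measurable_affine_rV m s)). Qed.

Lemma integrableM_gsmooth s m (k : 'rV[R]_d -> R) :
  gamma.-integrable [set: 'rV[R]_d] (EFin \o k) ->
  gamma.-integrable [set: 'rV[R]_d] (EFin \o (fun z => k z * g (m + s *: z))).
Proof.
move=> ik; apply: (le_integrableR (k := fun z => M * `|k z|)).
- apply: measurable_funM; last exact: measurable_gsmooth_integrand.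
  by case/integrableP : ik => /measurable_EFinP.
- by move=> z; rewrite normrM mulrC ler_wpM2r// ger0_norm.
- exact: integrableZlR (integrable_norm ik).
Qed.

Lemma integrable_gsmooth_integrand s m :
  gamma.-integrable [set: 'rV[R]_d] (EFin \o (fun z => g (m + s *: z))).
Proof.
have := integrableM_gsmooth s m (integrable_cstR gamma 1).
by under eq_fun do rewrite /= mul1r.
Qed.

Lemma gsmooth_ge0 s m : 0 <= gsmooth s m.
Proof. exact: Rintegral_ge0. Qed.

Lemma gsmooth_le s m : gsmooth s m <= M.
Proof.
rewrite -[leRHS](Rintegral_prob_cst gamma); apply: le_Rintegral => //.
- exact: integrable_gsmooth_integrand.
- exact: integrable_cstR.
Qed.

(** As m + h + s z = m + s (z + h / s), moving the centre amounts to shifting [z], which the tilt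
    absorbs. *)
Lemma gsmooth_shift s m h : 0 < s ->
  gsmooth s (m + h) = \int[gamma]_z (tilt (s^-1 *: h) z * g (m + s *: z)).
Proof.
move=> s0; rewrite /gsmooth /Rintegral; congr fine.
transitivity (\int[gamma]_z (g (m + s *: (z + s^-1 *: h)))%:E)%E.
  apply: eq_integral => z _; congr (g _)%:E.
  by rewrite scalerDr scalerA divff ?gt_eqF// scale1r [in RHS](addrC (s *: z)) addrA.
rewrite (@ge0_integral_gaussian_shift _ _ _ (fun z => (g (m + s *: z))%:E)).
- by apply: eq_integral => z _; rewrite -EFinM mulrC.
- by have /measurable_EFinP := measurable_gsmooth_integrand s m.
- by move=> z; rewrite lee_fin.
Qed.

(** This is the part of the tilted integral that is linear in [h]. *)
Lemma gsmooth_grad_dotp s m h : 0 < s ->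
  dotp (gsmooth_grad s m) h =
  \int[gamma]_z (dotp z (s^-1 *: h) * g (m + s *: z)).
Proof.
move=> s0; transitivity (\int[gamma]_z
    (\sum_(i < d) ((s^-1 * h ord0 i) * (z ord0 i * g (m + s *: z))))).
  rewrite Rintegral_sum; last first.
    by move=> i; apply: integrableZlR; exact/integrableM_gsmooth/integrable_coord.
  apply: eq_bigr => i _; rewrite mxE RintegralZl//; first by rewrite mulrAC.
  exact/integrableM_gsmooth/integrable_coord.
apply: eq_Rintegral => z _; rewrite /dotp mulr_suml.
by apply: eq_bigr => i _; rewrite mxE; ring.
Qed.

(* With x = z.u - |u|^2/2, the remainder |e^x - 1 - z.u| is at most
   (e^x - 1 - x) + |u|^2/2, where e^x - 1 - x >= 0 has mean |u|^2/2. *)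
Lemma gsmooth_taylor s m h : 0 < s ->
  `|gsmooth s (m + h) - gsmooth s m - dotp (gsmooth_grad s m) h| <=
  M * (s ^- 2 * dotp h h).
Proof.
move=> s0; rewrite gsmooth_shift// gsmooth_grad_dotp//.
set u := s^-1 *: h; have -> : s ^- 2 * dotp h h = dotp u u.
  by rewrite /u dotpZr dotpZl mulrA -expr2 exprVn.
have i1 := integrableM_gsmooth s m (integrable_tilt u).
have i2 := integrable_gsmooth_integrand s m.
have i3 := integrableM_gsmooth s m (integrable_dotp u).
have i12 := integrableBR i1 i2.
rewrite -RintegralB// -RintegralB//.
have ik1 := integrableBR (integrableDR (integrable_tilt u)
  (integrable_cstR gamma (dotp u u - 1))) (integrable_dotp u).
have ik := integrableZlR M ik1.
apply: (le_trans (Rintegral_le_norm (integrableBR i12 i3) ik _)).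
- move=> z /=; rewrite -[X in _ - X - _]mul1r -!mulrBl normrM mulrC.
  rewrite [X in X * _]ger0_norm//; apply: ler_pM => //.
  have := expR_ge1Dx (dotp z u - dotp u u / 2); rewrite -/(tilt u z).
  have := dotp_ge0 u => v0 t0.
  by rewrite ler_norml; apply/andP; split; lra.
- rewrite RintegralZl// RintegralB//=; last exact: integrable_dotp.
    rewrite RintegralD//=; [|exact: integrable_tilt|exact: integrable_cstR].
    by rewrite Rintegral_tilt Rintegral_prob_cst Rintegral_dotp subr0 addrC subrK.
  exact: integrableDR (integrable_tilt u) (integrable_cstR gamma (dotp u u - 1)).
Qed.

(** [gsmooth_taylor] along t e_i bounds the error of the difference quotient by M s^-2 |t|. *)
Lemma gradient_gsmooth s m : 0 < s -> gradient (gsmooth s) m = gsmooth_grad s m.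
Proof.
move=> s0; apply/rowP => i; rewrite [LHS]mxE; apply/cvg_lim => //.
set v := delta_mx ord0 i; set G := gsmooth_grad s m.
have vv : dotp v v = 1 by rewrite -coordE mxE !eqxx.
have Gv : dotp G v = G ord0 i by rewrite -coordE.
have M0 : 0 <= M by exact: le_trans (g0 0) (gM 0).
apply/cvgrPdist_le => e e0.
(* The 1 keeps the divisor positive even when M = 0. *)
have K0 : 0 < M * s ^- 2 + 1 by rewrite ltr_wpDl// mulr_ge0// invr_ge0 sqr_ge0.
near=> t.
have t0 : t != 0 by near: t; exact: nbhs_dnbhs_neq.
rewrite /= distrC [t *: v + m]addrC.
have H := gsmooth_taylor m (t *: v) s0.
rewrite -(ler_pM2l (_ : 0 < `|t|)) ?normr_gt0// -normrM mulrBr mulrA divff// mul1r.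
rewrite !dotpZr dotpZl -/G vv Gv mulr1 in H.
apply: (le_trans H).
have te : `|t| <= e / (M * s ^- 2 + 1).
  near: t; apply: dnbhs0_le; exact: divr_gt0.
rewrite ler_pdivlMr// in te.
rewrite -expr2 -(real_normK (num_real t)) mulrA expr2 mulrCA ler_wpM2l//.
have := normr_ge0 t; lra.
Unshelve. all: by end_near. Qed.

(** The bound is uniform in [m], so it gives integrability along the iterates whatever their law. *)
Lemma gsmooth_grad_coord_le s m i : 0 < s ->
  `|gsmooth_grad s m ord0 i| <= s^-1 * (M * \int[gamma]_z `|z ord0 i|).
Proof.
move=> s0; rewrite mxE normrM gtr0_norm ?invr_gt0// ler_pM2l ?invr_gt0//.
have ic := @integrable_coord R d i.
rewrite -RintegralZl//; last exact: integrable_norm.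
apply: Rintegral_le_norm.
- exact: integrableM_gsmooth.
- exact/integrableZlR/integrable_norm.
- by move=> z; rewrite normrM mulrC ler_wpM2r// ger0_norm.
Qed.

(** Coupling the two Gaussians through the same [z], the arguments of [g] differ by (s - s') z.
    Linearity in |s - s'| lets these costs telescope later. *)
Lemma gsmooth_lipschitz_scale (D : R) s s' m : 0 <= D ->
  (forall x y, `|g x - g y| <= D * enorm (x - y)) ->
  `|gsmooth s m - gsmooth s' m| <= `|s - s'| * (D * (1 + gauss_sqnorm R d)).
Proof.
move=> D0 gD; have i1 := integrable_gsmooth_integrand s m.
have i2 := integrable_gsmooth_integrand s' m.
have ik := integrableZlR (`|s - s'| * D)
  (integrableDR (integrable_cstR gamma 1) (@integrable_sqr_enorm R d)).
rewrite /gsmooth -RintegralB//.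
apply: (le_trans (Rintegral_le_norm (integrableBR i1 i2) ik _)).
  move=> z /=; apply: (le_trans (gD _ _)).
  rewrite opprD addrACA subrr add0r -scalerBl.
  have -> : enorm ((s - s') *: z) = `|s - s'| * enorm z.
    rewrite -sqrtr_sqr -sqrtrM ?sqr_ge0//; congr Num.sqrt.
    by rewrite mulr_sumr; apply: eq_bigr => i _; rewrite mxE exprMn.
  rewrite mulrCA mulrA ler_wpM2l// ?mulr_ge0//.
  (* Here |z| <= 1 + |z|^2. *)
  have := sqr_ge0 (enorm z - 1); have := sqr_ge0 (enorm z); nra.
rewrite RintegralZl//; last first.
  exact: (integrableDR (integrable_cstR gamma 1) (@integrable_sqr_enorm R d)).
rewrite RintegralD//=; [|exact: integrable_cstR|exact: integrable_sqr_enorm].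
by rewrite Rintegral_prob_cst mulrA.
Qed.

End gaussian_smoothing.

(** * Measurability of Lipschitz functions *)

Section lipschitz_measurable.
Variables (R : realType) (d : nat).
Implicit Types (x y : 'rV[R]_d) (f : 'rV[R]_d -> R).

(** The function is constant on each of countably many cells, and a cell is a finite intersection of
    coordinate preimages of half-open intervals. *)
Lemma measurable_fun_grid (c : R) (h : {ffun 'I_d -> int} -> R) :
  measurable_fun [set: 'rV[R]_d]
    (fun x => h [ffun i => Num.floor (c * x ord0 i)]).
Proof.
move=> _ B mB; rewrite setTI.
pose F (q : {ffun 'I_d -> int}) := [set x : 'rV[R]_d | B (h q) /\
  forall i, Num.floor (c * x ord0 i) = q i].
rewrite (_ : _ @^-1` B = \bigcup_q F q); last first.
  apply/seteqP; split=> x /=.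
    by move=> Bx; eexists; [|split; [exact: Bx|move=> i; rewrite ffunE]].
  move=> [q _ [Bq qE]]; rewrite (_ : [ffun i => _] = q)//.
  by apply/ffunP => i; rewrite ffunE.
apply: countable_bigcupT_measurable => // q.
have [Bq|nBq] := pselect (B (h q)); last first.
  by rewrite (_ : F q = set0)//; apply/seteqP; split=> x // [].
have -> : F q = \bigcap_(i in [set: 'I_d])
    (fun x : 'rV[R]_d => c * x ord0 i) @^-1` `[(q i)%:~R, (q i + 1)%:~R[%classic.
  apply/seteqP; split=> x /=.
    by move=> [_ qE] i _ /=; rewrite in_itv/= -floor_eq qE.
  by move=> H; split=> // i; apply/eqP; rewrite floor_eq; exact: H.
apply: fin_bigcap_measurable => // i _; rewrite -[X in measurable X]setTI.
have mi : measurable_fun [set: 'rV[R]_d] (fun x : 'rV[R]_d => c * x ord0 i).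
  by apply: measurable_funM => //; exact: measurable_rV_coord.
exact: mi.
Qed.

(** The sigma-algebra is generated by coordinates rather than by open sets, so [f] is written as the
    pointwise limit of its values on grids of mesh 1 / (n + 1). *)
Lemma elipschitz_measurable f (L : R) :
  elipschitz f L -> measurable_fun [set: 'rV[R]_d] f.
Proof.
move=> fL.
pose h n (q : {ffun 'I_d -> int}) : R := f (\row_i (n.+1%:R^-1 * (q i)%:~R)).
apply: (@measurable_fun_cvg _ _ _ _
  (fun n x => h n [ffun i => Num.floor (n.+1%:R * x ord0 i)])) => [n|x _].
  exact: measurable_fun_grid.
apply/cvgrPdist_le => e e0.
(* The sign of [L] is not prescribed, hence the absolute value. *)
have K0 : 0 < `|L| * Num.sqrt d%:R + 1 by rewrite ltr_wpDl// mulr_ge0// sqrtr_ge0.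
near=> n; apply: (le_trans (fL _ _)).
set y := x - _.
(* Each coordinate of [y] lies between 0 and the mesh 1 / (n + 1). *)
have ey : enorm y <= Num.sqrt d%:R * n.+1%:R^-1.
  have n0 : 0 <= n.+1%:R^-1 :> R by [].
  rewrite -[X in _ * X](ger0_norm n0) -sqrtr_sqr -sqrtrM// ler_sqrt; last first.
    by rewrite mulr_ge0// sqr_ge0.
  rewrite -[d in d%:R]card_ord -sum1_card natr_sum mulr_suml ler_sum// => i _.
  rewrite mul1r !mxE ffunE.
  have /andP[] := floor_itv (n.+1%:R * x ord0 i).
  set k : R := (Num.floor _)%:~R; rewrite intrD mulr1z -/k => h1 h2.
  have n1 : 0 < n.+1%:R :> R by [].
  have -> : x ord0 i - n.+1%:R^-1 * k = n.+1%:R^-1 * (n.+1%:R * x ord0 i - k).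
    by rewrite mulrBr mulrA mulVf ?mul1r// gt_eqF.
  rewrite exprMn ler_piMr ?sqr_ge0//.
  rewrite expr_le1//; lra.
have ne : n.+1%:R^-1 <= e / (`|L| * Num.sqrt d%:R + 1).
  near: n; have := @cvg_harmonic R => /cvgr0Pnorm_le.
  move=> /(_ (e / (`|L| * Num.sqrt d%:R + 1)) (divr_gt0 e0 K0)).
  by apply: filterS => n /=; rewrite ger0_norm.
rewrite ler_pdivlMr// in ne.
apply: (@le_trans _ _ (`|L| * (Num.sqrt d%:R * n.+1%:R^-1))).
  apply: (@le_trans _ _ (`|L| * enorm y)); last by rewrite ler_wpM2l.
  by rewrite ler_wpM2r ?ler_norm// sqrtr_ge0.
by rewrite mulrA mulrC (le_trans _ ne)// mulrDr mulr1 lerDl.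
Unshelve. all: by end_near. Qed.

End lipschitz_measurable.

(** * Bounds on the power transform *)

Section power_transform.
Variables (R : realType) (d : nat) (f : 'rV[R]_d -> R) (N L M : R).
Hypotheses (N0 : 0 < N) (fL : elipschitz f L) (fM : forall x, fpow f N x <= M).

Lemma fpow_ge0 x : 0 <= fpow f N x.
Proof. exact: expR_ge0. Qed.

Lemma measurable_fpow : measurable_fun [set: 'rV[R]_d] (fpow f N).
Proof.
apply: measurableT_comp => //; apply: measurable_funM => //.
exact: elipschitz_measurable fL.
Qed.

(** For B <= A, e^A - e^B = e^A (1 - e^(B - A)) <= e^A (A - B); the two orders of the values of [f]
    are symmetric. *)
Lemma fpow_lipschitz x y :
  `|fpow f N x - fpow f N y| <= N * M * `|L| * enorm (x - y).
Proof.
have M0 : 0 <= M by exact: le_trans (fpow_ge0 0) (fM 0).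
have aux a b : N * f b <= N * f a ->
    `|fpow f N a - fpow f N b| <= N * M * `|f a - f b|.
  move=> ba; have fab : 0 <= f a - f b by rewrite subr_ge0 -(ler_pM2l N0).
  rewrite (ger0_norm fab) ger0_norm ?subr_ge0 ?ler_expR//.
  have -> : fpow f N b = fpow f N a * expR (N * f b - N * f a).
    by rewrite -expRD addrC subrK.
  rewrite -[X in X - _]mulr1 -mulrBr -mulrA mulrCA; apply: ler_pM => //.
  - exact: fpow_ge0.
  - by rewrite subr_ge0 -[leRHS]expR0 ler_expR subr_le0.
  - have := expR_ge1Dx (N * f b - N * f a); lra.
have fxy : `|f x - f y| <= `|L| * enorm (x - y).
  by apply: (le_trans (fL _ _)); rewrite ler_wpM2r ?ler_norm// sqrtr_ge0.
rewrite -mulrA; apply: (@le_trans _ _ (N * M * `|f x - f y|)); last first.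
  by rewrite ler_wpM2l// mulr_ge0// ltW.
have [|/ltW] := lerP (N * f y) (N * f x); first exact: aux.
by move=> /aux; rewrite distrC [in leRHS]distrC.
Qed.

End power_transform.

Lemma smoothedE (R : realType) (d : nat) (f : 'rV[R]_d -> R) (N s : R) (m : 'rV[R]_d) :
  measurable_fun [set: 'rV[R]_d] (fpow f N) -> 0 < s ->
  smoothed f N s m = gsmooth (fpow f N) s m.
Proof.
move=> mg s0.
have mE : measurable_fun [set: 'rV[R]_d] (fun x => (fpow f N x)%:E).
  by have /measurable_EFinP := mg.
have E0 x : (0 <= (fpow f N x)%:E)%E by rewrite lee_fin fpow_ge0.
have H := ge0_integral_gaussian_affine m s0 mE E0.
by rewrite /smoothed unlock H.
Qed.

(** * One step of the iteration *)

Section joint_law.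
Variables (R : realType) (d : nat) (dO : measure_display) (Omega : measurableType dO).
Variables (P : probability Omega R) (m w : Omega -> 'rV[R]_d) (s : R).
Hypotheses (mm : measurable_fun [set: Omega] m) (mw : measurable_fun [set: Omega] w).
Hypothesis s0 : 0 < s.
Hypothesis law_w : forall A B : set 'rV[R]_d, measurable A -> measurable B ->
  P (m @^-1` A `&` w @^-1` B) =
  (\int[P]_(o in m @^-1` A) (fine (gaussian (m o) s B))%:E)%E.
Local Notation gamma := (gaussian (0 : 'rV[R]_d) 1).

Let mX1 : measurable_fun [set: Omega] (fun o => (m o, w o)).
Proof. exact: measurable_fun_pair. Qed.

Let X1 : {mfun Omega >-> ('rV[R]_d * 'rV[R]_d)%type} :=
  HB.pack (fun o => (m o, w o)) (isMeasurableFun.Build _ _ _ _ _ mX1).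

Lemma measurable_affine_pair :
  measurable_fun [set: Omega * 'rV[R]_d] (fun p => m p.1 + s *: p.2).
Proof.
apply/measurable_fun_rVP => i; under eq_fun do rewrite !mxE.
apply: measurable_funD; first exact:
  (measurableT_comp (measurable_rV_coord i) (measurableT_comp mm measurable_fst)).
apply: measurable_funM => //.
exact: (measurableT_comp (measurable_rV_coord i) measurable_snd).
Qed.

Let mX2 : measurable_fun [set: Omega * 'rV[R]_d]
  (fun p => (m p.1, m p.1 + s *: p.2)).
Proof.
apply: measurable_fun_pair; last exact: measurable_affine_pair.
exact: (measurableT_comp mm measurable_fst).
Qed.

Let X2 : {mfun (Omega * 'rV[R]_d)%type >-> ('rV[R]_d * 'rV[R]_d)%type} :=
  HB.pack (fun p : Omega * 'rV[R]_d => (m p.1, m p.1 + s *: p.2))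
    (isMeasurableFun.Build _ _ _ _ _ mX2).

(** [nu1] is the law of (m, w); [nu2] is that of (m, m + s z) with [z] a standard Gaussian
    independent of [m]. *)
Let nu1 := distribution P X1.
Let nu2 := distribution (P \x gamma)%E X2.

Let gaussianE o (B : set 'rV[R]_d) : measurable B ->
  gaussian (m o) s B = gamma ((fun z => m o + s *: z) @^-1` B).
Proof.
move=> mB.
have mE : measurable_fun [set: 'rV[R]_d] (fun x => (\1_B x)%:E : \bar R).
  by apply/measurable_EFinP; exact: measurable_indic.
have E0 (x : 'rV[R]_d) : (0 <= (\1_B x)%:E :> \bar R)%E by rewrite lee_fin.
have := ge0_integral_gaussian_affine (m o) s0 mE E0.
rewrite integral_indic// setIT => ->.
rewrite (_ : (fun x => _) = (fun z : 'rV[R]_d =>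
   (\1_((fun z => m o + s *: z) @^-1` B) z)%:E))//.
rewrite integral_indic ?setIT// -[X in measurable X]setTI.
exact: measurable_affine_rV.
Qed.

(** By [law_w] the two laws agree on rectangles, a generating family stable under intersection. *)
Let nu12 C : measurable C -> nu1 C = nu2 C.
Proof.
move=> mC.
apply: (measure_unique [set A `*` B | A in measurable & B in measurable] (fun=> setT)) => //.
- exact: measurable_prod_measurableType.
- move=> _ _ [A1 mA1 [B1 mB1 <-]] [A2 mA2 [B2 mB2 <-]]; rewrite -setXI.
  by exists (A1 `&` A2); [exact: measurableI|exists (B1 `&` B2)=> //; exact: measurableI].
- by move=> _; exists setT => //; exists setT => //; rewrite setXTT.
- by apply/seteqP; split=> // x _; exists 0%N.
- move=> _ [A mA [B mB <-]]; transitivity (P (m @^-1` A `&` w @^-1` B)); first by [].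
  rewrite law_w// /nu2 /distribution /pushforward.
  rewrite /product_measure1 integral_mkcond; apply: eq_integral => o _.
  rewrite patchE; case: ifPn => [oA|/negP oA] /=.
    rewrite fineK ?fin_num_measure// gaussianE//; congr (gamma _).
    apply/seteqP; split=> z /=; rewrite /xsection/= inE/=; last by case.
    by move=> zB; split => //; exact: set_mem.
  rewrite (_ : xsection _ o = set0) ?measure0//; apply/seteqP; split=> z //=.
  by rewrite /xsection/= inE/= => -[Ao _]; apply: oA; exact/mem_set.
- by move=> _; rewrite (le_lt_trans (probability_le1 _ _))// ltry.
Qed.

(** This turns the conditional law of the sample into an integral over an independent [z]. *)
Lemma ge0_integral_joint (h : 'rV[R]_d * 'rV[R]_d -> \bar R) :
  measurable_fun [set: 'rV[R]_d * 'rV[R]_d] h -> (forall x, (0 <= h x)%E) ->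
  (\int[P]_o h (m o, w o) = \int[P]_o \int[gamma]_z h (m o, m o + s *: z)%R)%E.
Proof.
move=> mh h0; transitivity (\int[nu1]_x h x)%E.
  by rewrite ge0_integral_distribution.
rewrite (eq_measure_integral nu2); last by move=> A mA _; exact: nu12.
rewrite ge0_integral_distribution// fubini_tonelli1//.
- exact: (measurableT_comp mh mX2).
- by move=> x; exact: h0.
Qed.

Variables (h k : 'rV[R]_d * 'rV[R]_d -> R) (c : R).
Hypotheses (mh : measurable_fun [set: 'rV[R]_d * 'rV[R]_d] h)
  (mk : measurable_fun [set: 'rV[R]_d * 'rV[R]_d] k).
Hypothesis hk : forall x, `|h x| <= k x.
Hypothesis kc : forall o, (\int[gamma]_z (k (m o, m o + s *: z)%R)%:E <= c%:E)%E.

Let k0 x : 0 <= k x. Proof. exact: le_trans (hk x). Qed.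

Let mEk : measurable_fun [set: 'rV[R]_d * 'rV[R]_d] (fun x => (k x)%:E).
Proof. by have /measurable_EFinP := mk. Qed.

Let mEh : measurable_fun [set: 'rV[R]_d * 'rV[R]_d] (fun x => (h x)%:E).
Proof. by have /measurable_EFinP := mh. Qed.

Let k0e x : (0 <= (k x)%:E)%E. Proof. by rewrite lee_fin. Qed.

Let iter_le : (\int[P]_o \int[gamma]_z (k (m o, m o + s *: z)%R)%:E <= c%:E)%E.
Proof.
apply: (@le_trans _ _ (\int[P]_o (cst c%:E o))%E); last first.
  by rewrite integral_cst//= probability_setT mule1.
apply: ge0_le_integral => //.
- by move=> o _; exact: integral_ge0.
- exact: (@measurable_fun_fubini_tonelli_F _ _ _ _ _ gamma _
    (measurableT_comp mEk mX2) (fun=> k0e _)).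
Qed.

Lemma integral_joint_le : (\int[P]_o (k (m o, w o))%:E <= c%:E)%E.
Proof. by rewrite (ge0_integral_joint mEk k0e). Qed.

Lemma integrable_joint :
  P.-integrable [set: Omega] (EFin \o (fun o => h (m o, w o))).
Proof.
apply: (le_integrableR (k := fun o => k (m o, w o))) => //.
- exact: (measurableT_comp mh mX1).
- apply: (ge0_integrableR _ _ integral_joint_le) => //.
  exact: (measurableT_comp mk mX1).
Qed.

(** Signed version, by Fubini: the bound [c] on the inner integrals of [k], uniform in [o], makes
    [h] integrable for the product and each inner integral finite. *)
Lemma Rintegral_joint : \int[P]_o h (m o, w o) =
  \int[P]_o \int[gamma]_z h (m o, m o + s *: z).
Proof.
have i2 : (P \x gamma)%E.-integrable [set: Omega * 'rV[R]_d]
    ((fun x => (h x)%:E) \o X2).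
  apply: (le_integrableR (h := fun p => h (X2 p)) (k := fun p => k (X2 p))) => //.
    exact: (measurableT_comp mh mX2).
  apply: (ge0_integrableR (r := c)) => //.
    exact: (measurableT_comp mk mX2).
  rewrite fubini_tonelli1//; exact: (measurableT_comp mEk mX2).
have i1 : P.-integrable [set: Omega] ((fun x => (h x)%:E) \o X1).
  exact: integrable_joint.
rewrite /Rintegral; congr fine.
transitivity (\int[nu1]_x (h x)%:E)%E; first by rewrite integral_distribution.
rewrite (eq_measure_integral nu2); last by move=> A mA _; exact: nu12.
rewrite integral_distribution// -integral12_prod_meas1//.
apply: eq_integral => o _; rewrite /Rintegral fineK//.
apply: integrable_fin_num => //.
have mo : measurable_fun [set: 'rV[R]_d] (fun z => X2 (o, z)).
  exact: (measurableT_comp mX2 (pair1_measurable o)).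
apply: (le_integrableR (h := fun z => h (X2 (o, z))) (k := fun z => k (X2 (o, z)))) => //.
  exact: (measurableT_comp mh mo).
exact: (ge0_integrableR (measurableT_comp mk mo) (fun=> k0 _) (kc o)).
Qed.

End joint_law.

(** * Measurability of the smoothing and its gradient in the centre *)

Section gsmooth_measurability.
Variables (R : realType) (d : nat) (g : 'rV[R]_d -> R) (M : R).
Hypothesis mg : measurable_fun [set: 'rV[R]_d] g.
Hypothesis g0 : forall x, 0 <= g x.
Hypothesis gM : forall x, g x <= M.
Local Notation gamma := (gaussian (0 : 'rV[R]_d) 1).

Let measurable_gsmooth_ge0 (s : R) (k : 'rV[R]_d -> R) :
  measurable_fun [set: 'rV[R]_d] k -> (forall z, 0 <= k z) ->
  measurable_fun [set: 'rV[R]_d] (fun m => \int[gamma]_z (k z * g (m + s *: z))).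
Proof.
move=> mk k0.
have mkg : measurable_fun [set: 'rV[R]_d * 'rV[R]_d]
    (fun p : 'rV[R]_d * 'rV[R]_d => (k p.2 * g (p.1 + s *: p.2))%:E).
  apply/measurable_EFinP; apply: measurable_funM.
    exact: (measurableT_comp mk measurable_snd).
  exact: (measurableT_comp mg
    (@measurable_affine_pair _ _ _ _ id s (@measurable_id _ _ setT))).
have kg0 (p : 'rV[R]_d * 'rV[R]_d) : (0 <= (k p.2 * g (p.1 + s *: p.2))%:E :> \bar R)%E.
  by rewrite lee_fin mulr_ge0.
have mF := @measurable_fun_fubini_tonelli_F _ _ _ _ _ gamma _ mkg kg0.
exact: (measurableT_comp (fine_measurable measurableT) mF).
Qed.

Lemma measurable_gsmooth s : measurable_fun [set: 'rV[R]_d] (gsmooth g s).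
Proof.
have := @measurable_gsmooth_ge0 s (fun=> 1) (measurable_cst _) (fun=> ler01).
by apply: eq_measurable_fun => m _; apply: eq_Rintegral => z _; rewrite mul1r.
Qed.

(** The Tonelli argument needs a nonnegative weight, so z_i is split as (|z_i| + z_i) - |z_i|. *)
Lemma measurable_gsmooth_grad s :
  measurable_fun [set: 'rV[R]_d] (gsmooth_grad g s).
Proof.
apply/measurable_fun_rVP => i; under eq_fun do rewrite mxE.
apply: measurable_funM => //.
have mi : measurable_fun [set: 'rV[R]_d] (fun z : 'rV[R]_d => z ord0 i).
  exact: measurable_rV_coord.
have mni : measurable_fun [set: 'rV[R]_d] (fun z : 'rV[R]_d => `|z ord0 i|).
  exact: measurableT_comp.
have m1 := @measurable_gsmooth_ge0 s (fun z => `|z ord0 i| + z ord0 i)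
  (measurable_funD mni mi).
have m2 := @measurable_gsmooth_ge0 s (fun z => `|z ord0 i|) mni.
have nz (z : 'rV[R]_d) : 0 <= `|z ord0 i| + z ord0 i.
  by have := ler_norm (- z ord0 i); rewrite normrN -subr_ge0 opprK.
have mB := measurable_funB (m1 nz) (m2 (fun=> normr_ge0 _)).
move: mB; apply: eq_measurable_fun => m _ /=.
have ic := @integrable_coord R d i.
have inc := integrable_norm ic.
rewrite -RintegralB//.
- by apply: eq_Rintegral => z _; rewrite -mulrBl addrC addKr.
- apply: (integrableM_gsmooth mg g0 gM); exact: (integrableDR inc ic).
- exact: (integrableM_gsmooth mg g0 gM).
Qed.

End gsmooth_measurability.

(** * Expected gain of one step at a fixed scale *)

Section descent.
Variables (R : realType) (d : nat) (dO : measure_display) (Omega : measurableType dO).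
Variables (P : probability Omega R) (K : nat) (m : Omega -> 'rV[R]_d)
  (w : 'I_K -> Omega -> 'rV[R]_d) (s a M : R) (g : 'rV[R]_d -> R).
Hypotheses (mm : measurable_fun [set: Omega] m)
  (mw : forall k, measurable_fun [set: Omega] (w k)).
Hypotheses (s0 : 0 < s) (K0 : (0 < K)%N).
Hypothesis law_w : forall k (A B : set 'rV[R]_d), measurable A -> measurable B ->
  P (m @^-1` A `&` w k @^-1` B) =
  (\int[P]_(o in m @^-1` A) (fine (gaussian (m o) s B))%:E)%E.
Hypothesis mg : measurable_fun [set: 'rV[R]_d] g.
Hypothesis g0 : forall x, 0 <= g x.
Hypothesis gM : forall x, g x <= M.
Local Notation gamma := (gaussian (0 : 'rV[R]_d) 1).
Local Notation G := (gsmooth_grad g s).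
Local Notation kappa := (gauss_sqnorm R d).

Let M0 : 0 <= M. Proof. exact: le_trans (g0 0) (gM 0). Qed.

(** For [g] = [fpow f N] this is convertible to [grad_estimate]. *)
Definition mean_step (v : 'I_K -> 'rV[R]_d) (x : 'rV[R]_d) : 'rV[R]_d :=
  K%:R^-1 *: \sum_(k < K) g (v k) *: (v k - x).

Let mfst i : measurable_fun [set: 'rV[R]_d * 'rV[R]_d]
  (fun p : 'rV[R]_d * 'rV[R]_d => p.1 ord0 i).
Proof. exact: (measurableT_comp (measurable_rV_coord i) measurable_fst). Qed.

Let msnd i : measurable_fun [set: 'rV[R]_d * 'rV[R]_d]
  (fun p : 'rV[R]_d * 'rV[R]_d => p.2 ord0 i).
Proof. exact: (measurableT_comp (measurable_rV_coord i) measurable_snd). Qed.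

(** For p = (current point, sample), [sqterm] and [lterm] are the contributions of one sample to the
    quadratic and linear Taylor terms; [absterm] dominates [lterm]. *)
Let sqterm (p : 'rV[R]_d * 'rV[R]_d) : R := g p.2 ^+ 2 * dotp (p.2 - p.1) (p.2 - p.1).
Let lterm (p : 'rV[R]_d * 'rV[R]_d) : R := g p.2 * dotp (G p.1) (p.2 - p.1).
Let absterm (p : 'rV[R]_d * 'rV[R]_d) : R :=
  \sum_(i < d) M * `|G p.1 ord0 i| * `|(p.2 - p.1) ord0 i|.

Let mg2 : measurable_fun [set: 'rV[R]_d * 'rV[R]_d] (fun p => g p.2).
Proof. exact: (measurableT_comp mg measurable_snd). Qed.

Let mG i : measurable_fun [set: 'rV[R]_d] (fun x => G x ord0 i).
Proof.
by have /measurable_fun_rVP := measurable_gsmooth_grad mg g0 gM s; exact.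
Qed.

Let mG1 i : measurable_fun [set: 'rV[R]_d * 'rV[R]_d]
  (fun p : 'rV[R]_d * 'rV[R]_d => G p.1 ord0 i).
Proof. exact: (measurableT_comp (mG i) measurable_fst). Qed.

Let mdiff i : measurable_fun [set: 'rV[R]_d * 'rV[R]_d]
  (fun p : 'rV[R]_d * 'rV[R]_d => (p.2 - p.1) ord0 i).
Proof. by under eq_fun do rewrite !mxE; exact: measurable_funB (msnd i) (mfst i). Qed.

Let msqterm : measurable_fun [set: 'rV[R]_d * 'rV[R]_d] sqterm.
Proof.
apply: measurable_funM; first exact: measurable_funX.
by apply: measurable_sum => i; exact: measurable_funM (mdiff i) (mdiff i).
Qed.

Let mlterm : measurable_fun [set: 'rV[R]_d * 'rV[R]_d] lterm.
Proof.
apply: measurable_funM => //.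
by apply: measurable_sum => i; exact: measurable_funM (mG1 i) (mdiff i).
Qed.

Let mabsterm : measurable_fun [set: 'rV[R]_d * 'rV[R]_d] absterm.
Proof.
apply: measurable_sum => i; apply: measurable_funM.
  apply: measurable_funM => //.
  exact: (measurableT_comp (@normr_measurable R setT) (mG1 i)).
exact: (measurableT_comp (@normr_measurable R setT) (mdiff i)).
Qed.

Let affineK (x z : 'rV[R]_d) : x + s *: z - x = s *: z.
Proof. by rewrite addrAC subrr add0r. Qed.

Let sq_le o : (\int[gamma]_z (sqterm (m o, m o + s *: z)%R)%:E <=
  (M ^+ 2 * s ^+ 2 * kappa)%:E)%E.
Proof.
have isq := integrableZlR (M ^+ 2 * s ^+ 2) (@integrable_sqr_enorm R d).
rewrite /kappa -RintegralZl//; last exact: integrable_sqr_enorm.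
rewrite /Rintegral fineK; last exact: integrable_fin_num isq.
apply: ge0_le_integral => //.
- move=> z _; rewrite lee_fin mulr_ge0 ?sqr_ge0//; exact: dotp_ge0.
- have mo : measurable_fun [set: 'rV[R]_d] (fun z => (m o, m o + s *: z)).
    by apply: measurable_fun_pair => //; exact: measurable_affine_rV.
  by apply/measurable_EFinP; exact: (measurableT_comp msqterm mo).
- by case/integrableP : isq.
move=> z _; rewrite lee_fin /sqterm/= affineK dotpZl dotpZr sqr_enormE.
rewrite [s * _]mulrA -expr2 mulrA ler_wpM2r ?dotp_ge0// ler_wpM2r ?sqr_ge0//.
by rewrite ler_pXn2r ?nnegrE ?M0 ?g0 ?gM.
Qed.

Let gradB i : R := s^-1 * (M * \int[gamma]_z `|z ord0 i|).

(** It serves integrability only, so the value of [c] does not enter the rate. *)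
Let abs_le : exists c, forall o,
  (\int[gamma]_z (absterm (m o, m o + s *: z)%R)%:E <= c%:E)%E.
Proof.
pose k (z : 'rV[R]_d) := \sum_(i < d) (M * gradB i * s) * `|z ord0 i|.
have ik : gamma.-integrable [set: 'rV[R]_d] (EFin \o k).
  apply: integrable_sumR => i; apply: integrableZlR.
  exact/integrable_norm/integrable_coord.
exists (\int[gamma]_z k z) => o; rewrite /Rintegral fineK; last exact: integrable_fin_num ik.
apply: ge0_le_integral => //.
- by move=> z _; rewrite lee_fin sumr_ge0// => i _; rewrite !mulr_ge0.
- have mo : measurable_fun [set: 'rV[R]_d] (fun z => (m o, m o + s *: z)).
    by apply: measurable_fun_pair => //; exact: measurable_affine_rV.
  by apply/measurable_EFinP; exact: (measurableT_comp mabsterm mo).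
- by case/integrableP : ik.
move=> z _; rewrite lee_fin; apply: ler_sum => i _ /=; rewrite affineK.
have -> : (s *: z) ord0 i = s * z ord0 i by rewrite mxE.
rewrite normrM (gtr0_norm s0) mulrA ler_wpM2r// ler_wpM2r ?(ltW s0)// ler_wpM2l//.
have := gsmooth_grad_coord_le mg g0 gM (m o) i s0; exact.
Qed.

Let lterm_abs p : `|lterm p| <= absterm p.
Proof.
rewrite /lterm normrM ger0_norm//.
apply: (@le_trans _ _ (M * `|dotp (G p.1) (p.2 - p.1)|)); first by rewrite ler_wpM2r.
rewrite /absterm; under [leRHS]eq_bigr do rewrite -mulrA.
rewrite -mulr_sumr ler_wpM2l//; apply: (le_trans (ler_norm_sum _ _ _)).
by apply: ler_sum => i _; rewrite normrM.
Qed.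

Let ilterm k : P.-integrable [set: Omega] (EFin \o (fun o => lterm (m o, w k o))).
Proof.
have [c lc] := abs_le.
exact: (integrable_joint mm (mw k) s0 (law_w k) mlterm mabsterm lterm_abs lc).
Qed.

Lemma integrable_sqr_gsmooth_grad :
  P.-integrable [set: Omega] (EFin \o (fun o => dotp (G (m o)) (G (m o)))).
Proof.
apply: (le_integrableR (k := fun=> \sum_(i < d) gradB i ^+ 2)).
- have mi i : measurable_fun [set: Omega] (fun o => G (m o) ord0 i).
    exact: (measurableT_comp (mG i) mm).
  by apply: measurable_sum => i; exact: measurable_funM (mi i) (mi i).
- move=> o; rewrite ger0_norm ?dotp_ge0//; apply: ler_sum => i _.
  rewrite -expr2 -(real_normK (num_real _)) lerXn2r ?nnegrE//.
    exact: le_trans (gsmooth_grad_coord_le mg g0 gM (m o) i s0).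
  exact: gsmooth_grad_coord_le.
- exact: integrable_cstR.
Qed.

(** With w = m + s z, the conditional mean of g(w) (w - m) is s E[z g(m + s z)] = s^2 G(m). *)
Let lterm_mean k :
  \int[P]_o lterm (m o, w k o) = s ^+ 2 * \int[P]_o dotp (G (m o)) (G (m o)).
Proof.
have [c lc] := abs_le.
rewrite (Rintegral_joint mm (mw k) s0 (law_w k) mlterm mabsterm lterm_abs lc).
rewrite -RintegralZl//; last exact: integrable_sqr_gsmooth_grad.
apply: eq_Rintegral => o _.
rewrite -dotpZr (gsmooth_grad_dotp mg g0 gM _ _ s0); apply: eq_Rintegral => z _.
rewrite /lterm/= affineK mulrC scalerA expr2 mulKf ?gt_eqF//; congr (_ * _).
by rewrite dotpZr dotpZr; congr (_ * _); apply: eq_bigr => i _; rewrite mulrC.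
Qed.

Let isqterm k : P.-integrable [set: Omega] (EFin \o (fun o => sqterm (m o, w k o))).
Proof.
have sq_norm p : `|sqterm p| <= sqterm p.
  by rewrite ger0_norm// mulr_ge0 ?sqr_ge0 ?dotp_ge0.
exact: (integrable_joint mm (mw k) s0 (law_w k) msqterm msqterm sq_norm sq_le).
Qed.

Let sqterm_mean k : \int[P]_o sqterm (m o, w k o) <= M ^+ 2 * s ^+ 2 * kappa.
Proof.
have sq_norm p : `|sqterm p| <= sqterm p.
  by rewrite ger0_norm// mulr_ge0 ?sqr_ge0 ?dotp_ge0.
rewrite -lee_fin /Rintegral fineK; last exact: integrable_fin_num (isqterm k).
exact: (integral_joint_le mm (mw k) s0 (law_w k) msqterm sq_norm sq_le).
Qed.

Let Kpos : 0 < K%:R :> R. Proof. by rewrite ltr0n. Qed.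

(** Nonnegativity of the empirical variance; it reduces the second moment of the averaged step to
    those of single samples. *)
Let sqr_mean_le (x : 'I_K -> R) :
  (K%:R^-1 * \sum_(k < K) x k) ^+ 2 <= K%:R^-1 * \sum_(k < K) x k ^+ 2.
Proof.
set A := K%:R^-1 * \sum_(k < K) x k.
have sE : \sum_(k < K) x k = K%:R * A by rewrite mulrA divff ?mul1r// gt_eqF.
have : 0 <= \sum_(k < K) (x k - A) ^+ 2 by apply: sumr_ge0 => k _; exact: sqr_ge0.
under eq_bigr do rewrite sqrrB.
rewrite big_split/= sumrB sumrMnl -mulr_suml sE sumr_const card_ord.
rewrite -[X in _ + X]mulr_natl => h.
rewrite [leRHS]mulrC ler_pdivlMr//; lra.
Qed.

Let dotp_mean_step_le o : dotp (mean_step (w^~ o) (m o)) (mean_step (w^~ o) (m o)) <=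
  K%:R^-1 * \sum_(k < K) sqterm (m o, w k o).
Proof.
rewrite /sqterm /dotp; under [X in _ <= _ * X]eq_bigr do rewrite mulr_sumr.
rewrite exchange_big/= mulr_sumr; apply: ler_sum => i _.
rewrite -expr2 mxE summxE; apply: (le_trans (sqr_mean_le _)).
rewrite ler_pM2l ?invr_gt0//; apply: ler_sum => k _.
by rewrite mxE exprMn expr2 -expr2.
Qed.

Let dotp_mean_step o : dotp (G (m o)) (mean_step (w^~ o) (m o)) =
  K%:R^-1 * \sum_(k < K) lterm (m o, w k o).
Proof.
rewrite dotpZr; congr (_ * _); rewrite /lterm /dotp.
under [in RHS]eq_bigr do rewrite mulr_sumr.
rewrite exchange_big/=; apply: eq_bigr => i _.
rewrite summxE mulr_sumr; apply: eq_bigr => k _.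
by rewrite [X in _ * X]mxE mulrCA.
Qed.

Lemma integrable_gsmooth (x : Omega -> 'rV[R]_d) s' : measurable_fun [set: Omega] x ->
  P.-integrable [set: Omega] (EFin \o (fun o => gsmooth g s' (x o))).
Proof.
move=> mx; apply: (le_integrableR (k := fun=> M)).
- exact: (measurableT_comp (measurable_gsmooth mg g0 s') mx).
- by move=> o; rewrite ger0_norm ?gsmooth_ge0// (gsmooth_le mg).
- exact: integrable_cstR.
Qed.

(** Expectation of the Taylor lower bound at [m] with increment [a] times the averaged step:
    [lterm_mean] evaluates the linear term and [sqterm_mean] bounds the quadratic one. *)
Lemma gsmooth_descent : measurable_fun [set: Omega]
    (fun o => m o + a *: mean_step (w^~ o) (m o)) ->
  \int[P]_o gsmooth g s (m o) + a * s ^+ 2 * \int[P]_o dotp (G (m o)) (G (m o))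
    - M ^+ 3 * kappa * a ^+ 2 <=
  \int[P]_o gsmooth g s (m o + a *: mean_step (w^~ o) (m o)).
Proof.
move=> mm'.
have i0 := integrable_gsmooth s mm.
have i1 := integrableZlR (a * K%:R^-1) (integrable_sumR (index_enum 'I_K) ilterm).
have i2 := integrableZlR (M * s ^- 2 * a ^+ 2 * K%:R^-1)
  (integrable_sumR (index_enum 'I_K) isqterm).
apply: (@le_trans _ _ (\int[P]_o (gsmooth g s (m o)
    + (a * K%:R^-1) * (\sum_(k < K) lterm (m o, w k o))
    - (M * s ^- 2 * a ^+ 2 * K%:R^-1) * (\sum_(k < K) sqterm (m o, w k o)))));
    last first.
  apply: le_Rintegral => //.
  - exact: (integrableBR (integrableDR i0 i1) i2).
  - exact: integrable_gsmooth.
  move=> o _; have Gv := dotp_mean_step o; have vv := dotp_mean_step_le o.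
  move: (mean_step _ _) Gv vv => v Gv vv.
  have := gsmooth_taylor mg g0 gM (m o) (a *: v) s0.
  rewrite ler_norml => /andP[+ _].
  rewrite !dotpZr dotpZl Gv.
  have : M * s ^- 2 * a ^+ 2 * dotp v v <=
      M * s ^- 2 * a ^+ 2 * (K%:R^-1 * \sum_(k < K) sqterm (m o, w k o)).
    rewrite ler_wpM2l// mulr_ge0 ?sqr_ge0// mulr_ge0//.
    by rewrite invr_ge0 sqr_ge0.
  lra.
rewrite RintegralB//; last exact: (integrableDR i0 i1).
rewrite RintegralD// RintegralZl; [|by []|exact: (integrable_sumR _ ilterm)].
rewrite RintegralZl; [|by []|exact: (integrable_sumR _ isqterm)].
rewrite (Rintegral_sum _ ilterm) (Rintegral_sum _ isqterm).
rewrite (eq_bigr _ (fun k _ => lterm_mean k)).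
set e := \int[P]_o dotp _ _; rewrite sumr_const card_ord -[_ * e *+ _]mulr_natl.
have -> : a / K%:R * (K%:R * (s ^+ 2 * e)) = a * s ^+ 2 * e.
  by field; rewrite gt_eqF.
rewrite lerD2l lerN2.
(* The factor s^2 of the second moment cancels the s^-2 of the Taylor constant, which makes the loss
   independent of the scale. *)
apply: (@le_trans _ _ (M * s ^- 2 * a ^+ 2 * K%:R^-1 *
    (\sum_(k < K) (M ^+ 2 * s ^+ 2 * kappa)))).
  rewrite ler_wpM2l ?ler_sum// mulr_ge0 ?invr_ge0// mulr_ge0 ?sqr_ge0//.
  by rewrite mulr_ge0// invr_ge0 sqr_ge0.
rewrite sumr_const card_ord -[X in _ * X <= _]mulr_natl.
by rewrite le_eqVlt; apply/orP; left; apply/eqP; field; rewrite !gt_eqF.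
Qed.

End descent.

(** * Summation over the steps *)

Section process_measurability.
Variables (R : realType) (d K : nat) (g : 'rV[R]_d -> R).
Hypothesis mg : measurable_fun [set: 'rV[R]_d] g.

Lemma measurable_mean_step_iter dS (S : measurableType dS) (a : R)
    (x : S -> 'rV[R]_d) (v : 'I_K -> S -> 'rV[R]_d) :
  measurable_fun [set: S] x -> (forall k, measurable_fun [set: S] (v k)) ->
  measurable_fun [set: S] (fun o => x o + a *: mean_step g (v^~ o) (x o)).
Proof.
move=> /measurable_fun_rVP mx mv; apply/measurable_fun_rVP => i.
under eq_fun do rewrite 3!mxE summxE.
apply: measurable_funD; first exact: mx.
do 2 apply: measurable_funM => //.
apply: measurable_sum => k; under eq_fun do rewrite 3!mxE.
apply: measurable_funM; first exact: (measurableT_comp mg (mv k)).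
by apply: measurable_funB => //; have /measurable_fun_rVP := mv k; exact.
Qed.

(** By induction [mu t] is a measurable function of the earlier samples, so the freshness hypothesis
    can be used on events about [mu t]. *)
Lemma past_measurable dO (Omega : measurableType dO)
    (w : nat -> 'I_K -> Omega -> 'rV[R]_d) (mu : nat -> Omega -> 'rV[R]_d)
    (alpha : nat -> R) (mu0 : 'rV[R]_d) :
  (forall o, mu 0%N o = mu0) ->
  (forall t o, mu t.+1 o = mu t o + alpha t *: mean_step g ((w t)^~ o) (mu t o)) ->
  forall t (A : set 'rV[R]_d), measurable A -> past w t (mu t @^-1` A).
Proof.
move=> mu_0 muS.
(* The generators of [past] are named so that [g_sigma_algebraType] makes [Omega] with the past a
   measurable space. *)
pose gen t := [set A | exists (u : nat) (k : 'I_K) (B : set 'rV[R]_d),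
  [/\ (u < t)%N, measurable B & A = w u k @^-1` B]].
have mW t u k : (u < t)%N ->
    measurable_fun [set: g_sigma_algebraType (gen t)] (w u k).
  move=> ut _ B mB; rewrite setTI; apply: sub_sigma_algebra.
  by exists u, k, B.
have mmu t : measurable_fun [set: g_sigma_algebraType (gen t)] (mu t).
  elim: t => [|t IH].
    by rewrite (_ : mu 0%N = cst mu0)//; apply/funext => o; exact: mu_0.
  rewrite (_ : mu t.+1 = fun o => mu t o + alpha t *: mean_step g ((w t)^~ o) (mu t o));
    last by apply/funext => o; exact: muS.
  apply: (@measurable_mean_step_iter _ (g_sigma_algebraType (gen t.+1))).
    move=> _ A mA; have := IH measurableT A mA.
    apply: sub_sigma_algebra2 => B [u [k [C [ut mC ->]]]].
    by exists u, k, C; split => //; rewrite ltnS ltnW.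
  by move=> k; exact: mW.
by move=> t A mA; have := mmu t measurableT A mA; rewrite setTI.
Qed.

End process_measurability.

(** Both [F] and [sg] telescope; then the bounds on their end values and on the sum of [y] apply. *)
Lemma sum_of_descent (R : realDomainType) (F x y sg : nat -> R) (M S s0 c1 c2 : R) :
  (forall t, F t + x t - c1 * y t <= F t.+1 + (sg t - sg t.+1) * c2) ->
  (forall t, 0 <= F t <= M) -> (forall T, sg 0%N - sg T <= s0) ->
  (forall T, \sum_(0 <= t < T) y t <= S) -> 0 <= c1 -> 0 <= c2 ->
  forall T, \sum_(0 <= t < T) x t <= M + c2 * s0 + c1 * S.
Proof.
move=> step F0M sg0 yS c10 c20 T.
have tele : \sum_(0 <= t < T) x t <=
    F T - F 0%N + c1 * (\sum_(0 <= t < T) y t) + (sg 0%N - sg T) * c2.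
  elim: T => [|T IH]; first by rewrite !big_nil !subrr mulr0 mul0r !addr0.
  rewrite !big_nat_recr//=; have := step T; move: IH; lra.
have := ler_wpM2l c10 (yS T); have := ler_wpM2r c20 (sg0 T).
have /andP[] := F0M 0%N; have /andP[] := F0M T; lra.
Qed.

(** * Rate for bounded Lipschitz [fpow f N], with explicit constant *)

Section convergence_rate.
Variables (R : realType) (d : nat) (f : 'rV[R]_d -> R) (N M D S sigma0 : R)
  (alpha : nat -> R) (mu0 : 'rV[R]_d).
Local Notation g := (fpow f N).
Local Notation kappa := (gauss_sqnorm R d).
Hypothesis mg : measurable_fun [set: 'rV[R]_d] g.
Hypothesis gM : forall x, g x <= M.
Hypothesis D0 : 0 <= D.
Hypothesis gD : forall x y, `|g x - g y| <= D * enorm (x - y).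
Hypothesis alpha0 : forall t, 0 < alpha t.
Hypothesis alphaS : forall T, \sum_(0 <= t < T) alpha t ^+ 2 <= S.
Hypothesis sigma0_gt0 : 0 < sigma0.

Let g0 : forall x, 0 <= g x. Proof. by move=> x; exact: fpow_ge0. Qed.

Let M0 : 0 <= M. Proof. exact: le_trans (g0 0) (gM 0). Qed.

Section run.
Variables (b beta : R) (K : nat).
Hypotheses (b0 : 0 < b) (beta01 : 0 <= beta < 1) (K0 : (0 < K)%N).
Variables (dO : measure_display) (Omega : measurableType dO)
  (P : probability Omega R) (w : nat -> 'I_K -> Omega -> 'rV[R]_d)
  (mu : nat -> Omega -> 'rV[R]_d).
Hypothesis run : gs_powerhp P w mu f N sigma0 beta b alpha mu0.
Local Notation sigma := (sigma_sched sigma0 beta b).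

Let b_le_sigma t : b <= sigma t.
Proof.
case/andP: beta01 => be0 _.
by rewrite /sigma_sched lerDr mulr_ge0 ?exprn_ge0// ltW.
Qed.

Let sigma_gt0 t : 0 < sigma t.
Proof. exact: lt_le_trans (b_le_sigma t). Qed.

Let sigma_decr t u : (t <= u)%N -> sigma u <= sigma t.
Proof.
case/andP: beta01 => be0 be1 tu.
by rewrite /sigma_sched lerD2r ler_pM2l// ler_wiXn2l// ltW.
Qed.

Let mw t k : measurable_fun [set: Omega] (w t k). Proof. by case: run. Qed.

Let muS t o : mu t.+1 o = mu t o + alpha t *: mean_step g ((w t)^~ o) (mu t o).
Proof. by case: run => _ _ ->. Qed.

Let mmu t : measurable_fun [set: Omega] (mu t).
Proof.
elim: t => [|t IH].
  have mu_0 : forall o, mu 0%N o = mu0 by case: run.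
  by rewrite (_ : mu 0%N = cst mu0)//; apply/funext.
rewrite (_ : mu t.+1 = fun o => mu t o + alpha t *: mean_step g ((w t)^~ o) (mu t o)).
  exact: measurable_mean_step_iter.
by apply/funext => o; exact: muS.
Qed.

(** Marginal of the joint law of the samples: all other events are the whole space and contribute
    factors 1. *)
Let law_w t k (A B : set 'rV[R]_d) : measurable A -> measurable B ->
  P (mu t @^-1` A `&` w t k @^-1` B) =
  (\int[P]_(o in mu t @^-1` A) (fine (gaussian (mu t o) (sigma t.+1) B))%:E)%E.
Proof.
move=> mA mB; have [_ mu_0 _ fresh] := run.
have pA : past w t (mu t @^-1` A) by exact: (past_measurable mg mu_0 muS).
pose C j := if j == k then B else [set: 'rV[R]_d].
have mC j : measurable (C j) by rewrite /C; case: ifP.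
have := fresh t (mu t @^-1` A) C pA mC.
rewrite (_ : [set o | forall j, C j (w t j o)] = w t k @^-1` B); last first.
  apply/seteqP; split=> o /=; first by move=> /(_ k); rewrite /C eqxx.
  by move=> Bo j; rewrite /C; case: eqP => [->|].
move=> ->; apply: eq_integral => o _; congr EFin.
rewrite (bigD1 k)//= /C eqxx big1 ?mulr1// => j /negbTE ->.
by rewrite probability_setT.
Qed.

(** The scale index is one ahead, as step t samples around [mu t] with deviation [sigma t.+1]. *)
Let F t := \int[P]_o gsmooth g (sigma t.+1) (mu t o).
Let G t o := gsmooth_grad g (sigma t.+1) (mu t o).
Let e t := \int[P]_o dotp (G t o) (G t o).

(** A gain at the fixed scale [sigma t.+1], followed by the cost of passing to [sigma t.+2] at the
    new point. *)
Let descent_step t :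
  F t + alpha t * sigma t.+1 ^+ 2 * e t - M ^+ 3 * kappa * alpha t ^+ 2 <=
  F t.+1 + (sigma t.+1 - sigma t.+2) * (D * (1 + kappa)).
Proof.
have mmS := @measurable_mean_step_iter _ _ _ _ mg _ _ (alpha t) _ _ (mmu t) (mw t).
apply: (le_trans (gsmooth_descent (mmu t) (mw t) (sigma_gt0 t.+1) K0 (law_w t)
  mg g0 gM mmS)).
set F' := \int[P]_o _; set c := _ * (D * _).
have F'E : F' = \int[P]_o gsmooth g (sigma t.+1) (mu t.+1 o).
  by apply: eq_Rintegral => o _; rewrite muS.
have i1 := integrable_gsmooth P mg g0 gM (sigma t.+2) (mmu t.+1).
have i2 := integrable_gsmooth P mg g0 gM (sigma t.+1) (mmu t.+1).
have ic := integrable_cstR P c.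
have -> : F t.+1 + c = \int[P]_o (gsmooth g (sigma t.+2) (mu t.+1 o) + c).
  by rewrite (RintegralD measurableT i1 ic) Rintegral_prob_cst.
rewrite F'E; apply: (le_Rintegral measurableT i2 (integrableDR i1 ic)).
move=> o _; rewrite -lerBlDl.
have s12 : 0 <= sigma t.+1 - sigma t.+2 by rewrite subr_ge0 sigma_decr.
have h := gsmooth_lipschitz_scale mg g0 gM (sigma t.+1) (sigma t.+2) (mu t.+1 o) D0 gD.
rewrite (ger0_norm s12) in h; exact: (le_trans (ler_norm _) h).
Qed.

Let F_ge0 t : 0 <= F t.
Proof. by apply: Rintegral_ge0 => o _; exact: gsmooth_ge0. Qed.

Let F_le t : F t <= M.
Proof.
rewrite -[leRHS](Rintegral_prob_cst P); apply: le_Rintegral => //.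
- exact: integrable_gsmooth.
- exact: integrable_cstR.
- by move=> o _; exact: gsmooth_le.
Qed.

Let sum_le T : \sum_(0 <= t < T) alpha t * sigma t.+1 ^+ 2 * e t <=
  M + D * (1 + kappa) * sigma0 + M ^+ 3 * kappa * S.
Proof.
have k0 := gauss_sqnorm_ge0 R d.
apply: (sum_of_descent (sg := fun t => sigma t.+1) descent_step _ _ alphaS).
- by move=> t; rewrite F_ge0 F_le.
(* The first scale is sigma0 beta + b and all later ones are at least b, so the total decrease is at
   most sigma0 beta <= sigma0. *)
- case/andP: beta01 => be0 be1 t.
  have := b_le_sigma t.+1; rewrite lerBlDr => bs.
  rewrite {1}/sigma_sched expr1 lerD// ler_piMr// ltW//.
- by rewrite mulr_ge0// exprn_ge0.
- by rewrite mulr_ge0// addr_ge0.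
Qed.

Let nuE t : 'E_P[(fun o => enorm (gradient (smoothed f N (sigma t.+1)) (mu t o)) ^+ 2)%R]%E
  = (e t)%:E.
Proof.
rewrite unlock /e /Rintegral fineK; last first.
  apply: integrable_fin_num => //.
  exact: (integrable_sqr_gsmooth_grad P (mmu t) (sigma_gt0 t.+1) mg g0 gM).
apply: eq_integral => o _; rewrite sqr_enormE.
have -> : smoothed f N (sigma t.+1) = gsmooth g (sigma t.+1).
  by apply/funext => x; exact: (smoothedE x mg (sigma_gt0 t.+1)).
by rewrite (gradient_gsmooth mg g0 gM (mu t o) (sigma_gt0 t.+1)).
Qed.

(** If [e t] exceeded the bound for every t < T, the weighted sum in [sum_le] would exceed its
    bound. *)
Lemma nu_le T : (0 < T)%N ->
  (nu P mu f N sigma0 beta b T <=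
    ((M + D * (1 + kappa) * sigma0 + M ^+ 3 * kappa * S) *
     (sigma0 * beta ^+ T + b) ^- 2 * (\sum_(0 <= t < T) alpha t)^-1)%:E)%E.
Proof.
move=> T0; set C := M + _ + _; set A := \sum_(0 <= t < T) alpha t.
have A0 : 0 < A.
  rewrite /A; case: (T) T0 => // n _; rewrite big_nat_recr//= ltr_wpDl//.
  by apply: sumr_ge0 => i _; exact: ltW.
set c := C * _ * _.
have [t tT et] : exists2 t, (t < T)%N & e t <= c.
  apply: contrapT => nex.
  have ec t : (t < T)%N -> c < e t.
    by move=> tT; rewrite ltNge; apply/negP => h; apply: nex; exists t.
  have : \sum_(0 <= t < T) alpha t * sigma t.+1 ^+ 2 * c <
         \sum_(0 <= t < T) alpha t * sigma t.+1 ^+ 2 * e t.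
    apply: ltr_sum_nat => // t /andP[_ tT]; rewrite ltr_pM2l ?ec//.
    by rewrite mulr_gt0// exprn_gt0.
  apply/negP; rewrite -leNgt (le_trans (sum_le T))// -/C.
  have k0 := gauss_sqnorm_ge0 R d.
  have S0 : 0 <= S by rewrite (le_trans _ (alphaS 0))// big_nil.
  have C0 : 0 <= C.
    apply: addr_ge0; last by rewrite !mulr_ge0// exprn_ge0.
    by rewrite addr_ge0// !mulr_ge0// ?addr_ge0// ltW.
  have sT : sigma0 * beta ^+ T + b = sigma T by [].
  (* [c] is C divided by sigma_T^2 times the sum of the steps; as t + 1 <= T, each weight
     sigma_(t+1)^2 is at least sigma_T^2. *)
  have cE : C = \sum_(0 <= t < T) alpha t * sigma T ^+ 2 * c.
    rewrite -mulr_suml -mulr_suml -/A /c sT; field.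
    by rewrite !gt_eqF.
  rewrite cE; apply: ler_sum_nat => t /andP[_ tT].
  rewrite ler_wpM2r//.
    by rewrite mulr_ge0 ?invr_ge0 ?(ltW A0)// mulr_ge0// invr_ge0 sqr_ge0.
  rewrite ler_pM2l// lerXn2r ?nnegrE ?(ltW (sigma_gt0 _))//.
  exact: sigma_decr.
(* The index found is below T, while the minimum in [nu] runs up to T inclusive. *)
have tT1 : (t < T.+1)%N by rewrite ltnS ltnW.
by apply: (bigmin_inf (Ordinal tT1)) => //=; rewrite nuE lee_fin.
Qed.

End run.

Lemma nu_bound_smoothing :
  nu_bound f N sigma0 alpha mu0
    (M + D * (1 + kappa) * sigma0 + M ^+ 3 * kappa * S).
Proof.
by move=> b beta K b0 be K0 dO Omega P w mu run T T0; exact: (nu_le b0 be K0 run T0).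
Qed.

End convergence_rate.

Theorem corollary1 (R : realType) (d : nat) (f : 'rV[R]_d -> R)
    (xstar : 'rV[R]_d) (Lf : R) (alpha : nat -> R) (mu0 : 'rV[R]_d)
    (sigma0 : R) :
  continuous f ->
  tends_to_ninfty f ->
  unique_argmax f xstar ->
  elipschitz f Lf ->
  (forall t, 0 < alpha t) ->
  cvgn (series (fun t => alpha t ^+ 2)) ->
  series alpha @ \oo --> +oo ->
  0 < sigma0 ->
  (forall N : R, 0 < N ->
    exists C : R, 0 < C /\ nu_bound f N sigma0 alpha mu0 C) /\
  ((forall x, f x < 0) ->
    exists C : R, 0 < C /\
      forall N : R, 0 < N -> nu_bound f N sigma0 alpha mu0 C).
Proof.
move=> _ _ [fmax _] fL alpha0 cvg_alpha _ sigma0_gt0.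
set kappa := gauss_sqnorm R d.
have k0 : 0 <= kappa by exact: gauss_sqnorm_ge0.
pose S := limn (series (fun t => alpha t ^+ 2)).
have alphaS T : \sum_(0 <= t < T) alpha t ^+ 2 <= S.
  apply: (nondecreasing_cvgn_le _ cvg_alpha T).
  by apply: nondecreasing_series => n _ _; exact: sqr_ge0.
have S0 : 0 <= S by rewrite (le_trans _ (alphaS 0))// big_nil.
have mg N := measurable_fpow N fL.
have C_gt0 M D : 0 < M -> 0 <= D ->
    0 < M + D * (1 + kappa) * sigma0 + M ^+ 3 * kappa * S.
  move=> M0 D0; rewrite -addrA ltr_wpDr//.
  by rewrite addr_ge0// !mulr_ge0 ?addr_ge0 ?exprn_ge0// ltW.
have gM N x : 0 < N -> fpow f N x <= fpow f N xstar.
  by move=> N0; rewrite ler_expR ler_pM2l.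
split=> [N N0|fneg].
  (* [M] is the maximum of e^(N f), and [D] the Lipschitz constant from [fpow_lipschitz]. *)
  set M := fpow f N xstar; set D := N * M * `|Lf|.
  have M0 : 0 < M by exact: expR_gt0.
  have D0 : 0 <= D by rewrite !mulr_ge0// ltW.
  exists (M + D * (1 + kappa) * sigma0 + M ^+ 3 * kappa * S); split; first exact: C_gt0.
  apply: nu_bound_smoothing => //; first by move=> x; exact: gM.
  by apply: fpow_lipschitz => // x; exact: gM.
set D := `|Lf| / - f xstar.
have fx : 0 < - f xstar by rewrite oppr_gt0.
have D0 : 0 <= D by rewrite divr_ge0// ltW.
exists (1 + D * (1 + kappa) * sigma0 + 1 ^+ 3 * kappa * S); split; first exact: C_gt0.
move=> N N0; apply: nu_bound_smoothing => //.
  by move=> x; rewrite -expR0 ler_expR pmulr_rle0// ltW.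
move=> x y; apply: (le_trans (fpow_lipschitz N0 fL (gM N ^~ N0) x y)).
rewrite ler_wpM2r ?sqrtr_ge0// /D mulrC ler_wpM2l// -[leRHS]mul1r ler_pdivlMr//.
(* With z = N * f xstar, this is - z e^z <= 1, that is - z <= e^-z. *)
rewrite mulrAC mulrN.
set z := N * f xstar; rewrite /fpow -/z.
rewrite -(expRxMexpNx_1 z) mulrC ler_wpM2l ?expR_ge0//.
have := expR_ge1Dx (- z); lra.
Qed.
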